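(* Let $G$ be a plane $st$-graph such that, for every internal face $f$ of $G$, the left path of $f$ contains at least two edges and the right path of $f$ contains at least three edges. Then $G$ admits an embedding-preserving 2UBE.
   Context: Digraphs are finite, without loops and without multiple edges. A planar $st$-graph is a directed acyclic graph with a single source $s$ and a single sink $t$ that admits a planar embedding with $s$ and $t$ on the outer face; together with such an embedding it is called a plane $st$-graph. The left (right) face of an edge $e=(u,v)$ is the face to the left (right) of $e$ when moving from $u$ to $v$. The boundary of every internal face $f$ of a plane $st$-graph consists of two directed paths from a common source $s_f$ to a common sink $t_f$: the left path of $f$ consists of the boundary edges whose right face is $f$, and the right path of $f$ consists of the boundary edges whose left face is $f$. A 2UBE (upward 2-page book embedding) of a digraph $G=(V,E)$ is a pair $\langle\pi,\sigma\rangle$, where $\pi:V\to\{1,\dots,|V|\}$ is a bijection with $\pi(u)<\pi(v)$ for every directed edge $(u,v)$, and $\sigma:E\to\{L,R\}$ assigns edges to the left or right page so that no two edges $(a,b),(c,d)$ in the same page satisfy $\pi(a)<\pi(c)<\pi(b)<\pi(d)$. Its canonical drawing $\Gamma(\pi,\sigma)$ in the plane places each vertex $v$ on a vertical line (the spine) at $y$-coordinate $\pi(v)$ and draws each edge as a circular arc in the half-plane to the left (if $\sigma(e)=L$) or to the right (if $\sigma(e)=R$) of the spine; this is a planar drawing. For a plane $st$-graph $G$, a 2UBE $\langle\pi,\sigma\rangle$ is embedding-preserving if $\Gamma(\pi,\sigma)$ has the given planar embedding of $G$ (same internal and external faces). *)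

(* Defs.v *)
From HB Require Import structures.
From mathcomp Require Import all_boot all_order all_algebra.

Set Implicit Arguments.
Unset Strict Implicit.
Unset Printing Implicit Defensive.

Import Order.TTheory GRing.Theory Num.Theory.

Section Digraph.

Variables (V : finType) (e : rel V).

Definition edges : {set V * V} := [set x | e x.1 x.2].

Definition acyclic : Prop := forall u v, e u v -> ~~ connect e v u.

Definition is_source (v : V) : bool := [forall u, ~~ e u v].
Definition is_sink (v : V) : bool := [forall w, ~~ e v w].

Definition st_graph (s t : V) : Prop :=
  [/\ acyclic, forall v, is_source v = (v == s)
    & forall v, is_sink v = (v == t)].

Definition adj : rel V := fun v w => e v w || e w v.

End Digraph.

(* A planar embedding is encoded, up to orientation-preserving homeomorphism  *)
(* of the plane, by the counterclockwise cyclic order of the neighbours       *)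
(* around each vertex (the first item of the sequence is immaterial) together *)
(* with the outer face. In an acyclic digraph the dart (u, v) determines the  *)
(* edge joining u and v and a direction of traversal.                         *)
Record embedding (V : finType) := Embedding {
  rotation : V -> seq V;
  outer_face : {set V * V}
}.

Section Faces.

Variables (V : finType) (e : rel V) (M : embedding V).

Definition rotation_system : Prop :=
  forall v, uniq (rotation M v) /\ rotation M v =i adj e v.

(* An isolated vertex v contributes the degenerate dart (v, v), which is a    *)
(* fixed point of face_next: the one-vertex graph has exactly one face.       *)
Definition darts : {set V * V} :=
  [set d | (d.2 \in rotation M d.1)
           || ((d.1 == d.2) && nilp (rotation M d.1))].

(* Walking along (u, v) with the face on the left, the walk continues at v    *)
(* with the edge that precedes {u, v} counterclockwise around v. A face is    *)
(* the set of darts that have it on their left.                               *)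
Definition face_next (d : V * V) : V * V := (d.2, prev (rotation M d.2) d.1).

Definition face_of (d : V * V) : {set V * V} :=
  [set d' | fconnect face_next d d'].

Definition faces : {set {set V * V}} := [set face_of d | d in darts].

Definition internal_faces : {set {set V * V}} := faces :\ outer_face M.

Definition on_face (v : V) (f : {set V * V}) : bool :=
  [exists w, (v, w) \in f].

(* Euler's formula with a single component: st-graphs are connected, so this  *)
(* says that the rotation system has genus 0.                                 *)
Definition euler_planar : Prop := #|V| + #|faces| = #|edges e| + 2.

Definition left_face (x : V * V) : {set V * V} := face_of (x.1, x.2).
Definition right_face (x : V * V) : {set V * V} := face_of (x.2, x.1).

Definition left_path (f : {set V * V}) : {set V * V} :=
  [set x in edges e | right_face x == f].
Definition right_path (f : {set V * V}) : {set V * V} :=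
  [set x in edges e | left_face x == f].

Definition plane_st_graph (s t : V) : Prop :=
  [/\ st_graph e s t, rotation_system, euler_planar,
      outer_face M \in faces
    & on_face s (outer_face M) && on_face t (outer_face M)].

End Faces.

Definition same_embedding (V : finType) (M M' : embedding V) : Prop :=
  (forall v, exists k, rotation M' v = rot k (rotation M v))
  /\ outer_face M' = outer_face M.

Variant page := LeftPage | RightPage.

Section BookEmbedding.

Variables (V : finType) (e : rel V).
(* Spine positions are numbered from 0, and only the values of sigma on edges *)
(* are relevant.                                                              *)
Variables (pi : V -> 'I_#|V|) (sigma : V * V -> page).

Definition two_UBE : Prop :=
  [/\ bijective pi,
      forall u v, e u v -> pi u < pi v
    & forall a b c d, e a b -> e c d -> sigma (a, b) = sigma (c, d) ->
        ~ [/\ pi a < pi c, pi c < pi b & pi b < pi d]].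

Definition arc_page (v w : V) : page :=
  if e v w then sigma (v, w) else sigma (w, v).

(* Put v at the origin, with the y-axis as the spine, and let w be at (0, d), *)
(* where d = pi w - pi v. The arc joining them lies on the circle             *)
(* x^2 + y^2 = d y, so it meets the circle of radius r < 1 about v at height  *)
(* y = r^2 / d. The constant factor r^2 is dropped.                           *)
Definition arc_height (v w : V) : rat :=
  (((pi w)%:R - (pi v)%:R)^-1)%R.

(* Counterclockwise order of the arcs at v, read on this small circle from    *)
(* its lowest point: up along the right half, then down along the left half.  *)
Definition ccw_le (v w w' : V) : bool :=
  match arc_page v w, arc_page v w' with
  | RightPage, RightPage => (arc_height v w <= arc_height v w')%R
  | RightPage, LeftPage => true
  | LeftPage, RightPage => false
  | LeftPage, LeftPage => (arc_height v w' <= arc_height v w)%R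
  end.

Definition canonical_rotation (v : V) : seq V :=
  sort (ccw_le v) (enum (adj e v)).

(* The unbounded face contains the open ray that goes down from the lowest    *)
(* vertex v, and hence the angle between the last and the first arc at v; the *)
(* last arc, traversed from v, has this angle on its left.                    *)
Definition canonical_outer_face : {set V * V} :=
  [set d | [exists v, (pi v == 0 :> nat) &&
     (d \in face_of (Embedding canonical_rotation set0)
              (v, last v (canonical_rotation v)))]].

(* The planar embedding determined by the canonical drawing.                  *)
Definition canonical_embedding : embedding V :=
  Embedding canonical_rotation canonical_outer_face.

Definition embedding_preserving (M : embedding V) : Prop :=
  same_embedding M canonical_embedding.

End BookEmbedding.

(* Main.v *)
(* Counting the angles at the vertices against Euler's formula shows that     *)
(* every face has one source and one sink and that the incoming edges of a    *)
(* vertex are consecutive around it; so the edges at each vertex are ordered  *)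
(* from left to right, and the faces are two directed paths each.             *)
(*                                                                            *)
(* The book embedding is then built by adding internal faces to the right of  *)
(* a frontier, a directed st-path that starts as the left outer path. Call a  *)
(* frontier edge tight if its ends are consecutive on the spine, loose        *)
(* otherwise. The invariant is that no two consecutive frontier edges are     *)
(* loose, that the frontier is on the right page, and that no right edge      *)
(* passes over a frontier vertex. When a face is added, its left path is on   *)
(* the frontier, and as it has two edges one of them is tight. The new inner  *)
(* vertices of its right path are put inside one or two tight edges of the    *)
(* left path, which move to the left page: the first and the last edge are    *)
(* used when they are tight, and then the right path, having two inner        *)
(* vertices, again begins resp. ends with a tight edge. Since the moved edges *)
(* are tight, the left page stays planar, and both the planarity of the right *)
(* page and the rotations follow from the absence of right edges over the     *)
(* frontier.                                                                  *)

(* The record [ordered_st_graph] separates topology from construction.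

   From the embedding to lists ([plane_ordered]): going around a face, the direction must turn from
   up to down and back at least once, and around a vertex other than [s] and [t] the neighbours must
   switch from in to out and back. Counting darts, Euler's formula leaves no room for further turns
   ([angle_counts]). So every rotation can be cut into in- and out-neighbours read from left to
   right ([cut_rotation]), and every internal face is bounded by two monotone paths
   ([face_right_paths]), whose lengths are bounded below by hypothesis.

   From lists to a book ([book_order]): faces are swept as described above, with [sweep_state] as
   invariant and [sweep_insert] as inductive step. The left path has at least two edges, so it
   contains a tight edge to open. The right path has at least two inner vertices, so both of its
   ends can be made tight at once when the frontier needs it ([no_two_loose']). Right edges over the
   new frontier are excluded by [cover'], which also yields the planarity of the right page.

   Back to the embedding ([embedding_preserving_rank]): the order clauses of the invariant say that
   the arcs at each vertex appear in the prescribed left-to-right order, and the outer face is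
   recognised at [s], the lowest vertex. *)
Require Import Defs.
From mathcomp Require Import all_boot all_order all_algebra.
From mathcomp Require Import zify.

Set Implicit Arguments.
Unset Strict Implicit.
Unset Printing Implicit Defensive.

Import Order.TTheory GRing.Theory Num.Theory.

(** * Walks *)

Section Walk.

Variable V : eqType.
Implicit Types (u v w : V) (p q : seq V) (d : V * V).

(** Pairs serve both as directed edges along the frontier and as darts around a face. *)
Definition walk u p : seq (V * V) := pairmap pair u p.

Lemma walk_cat u p q : walk u (p ++ q) = walk u p ++ walk (last u p) q.
Proof. exact: pairmap_cat. Qed.

Lemma walk_rcons u p w : walk u (rcons p w) = rcons (walk u p) (last u p, w).
Proof. by rewrite -!cats1 walk_cat. Qed.

Lemma unzip2_walk u p : unzip2 (walk u p) = p.
Proof. by elim: p u => //= w p IH u; rewrite IH. Qed.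

Lemma unzip1_walk u p : unzip1 (walk u p) = belast u p.
Proof. by elim: p u => //= w p IH u; rewrite IH. Qed.

Lemma path_walk (r : rel V) u p : path r u p = all (fun d => r d.1 d.2) (walk u p).
Proof. by elim: p u => //= w p IH u; rewrite IH. Qed.

Lemma walk_head_in u p d : d \in walk u p -> d.2 \in p.
Proof. by move=> dp; rewrite -(unzip2_walk u p) map_f. Qed.

Lemma walk_tail_in u p d : d \in walk u p -> d.1 \in belast u p.
Proof. by move=> dp; rewrite -unzip1_walk map_f. Qed.

Lemma walk_into u p w : w \in p -> exists v, (v, w) \in walk u p.
Proof. by rewrite -{1}(unzip2_walk u p) => /mapP[[v x] vx /= ->]; exists v. Qed.

Lemma walk_from u p v : v \in belast u p -> exists w, (v, w) \in walk u p.
Proof. by rewrite -unzip1_walk => /mapP[[w x] vx /= ->]; exists x. Qed.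

Lemma walk_inj2 u p v v' w :
  uniq p -> (v, w) \in walk u p -> (v', w) \in walk u p -> v = v'.
Proof.
move=> Up vw v'w.
suff inj2 : {in walk u p &, injective snd} by case: (inj2 _ _ vw v'w erefl).
have : uniq (unzip2 (walk u p)) by rewrite unzip2_walk.
elim: (walk u p) {vw v'w} => //= d l IH /andP[dl Ul] a b.
rewrite !inE => /predU1P[->|al] /predU1P[->|bl] // ab; last exact: IH.
  by rewrite ab map_f in dl.
by rewrite -ab map_f in dl.
Qed.

Lemma walk_inj1 u p v w w' :
  uniq (u :: p) -> (v, w) \in walk u p -> (v, w') \in walk u p -> w = w'.
Proof.
elim: p u => // a p IH u /= /andP[up Up]; rewrite !inE.
have no b : (u, b) \in walk a p -> False.
  by move/walk_tail_in/mem_belast; rewrite (negPf up).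
case/predU1P=> [[-> ->]|vw] /predU1P[[]|vw'] //.
- by case: (no w').
- by move=> eq_vu _; case: (no w); rewrite -eq_vu.
- exact: IH Up vw vw'.
Qed.

Lemma walk_index u p v w : uniq (u :: p) -> (v, w) \in walk u p ->
  index w (u :: p) = (index v (u :: p)).+1.
Proof.
elim: p u => // a p IH u /[dup] Uup /= /andP[up Up].
rewrite inE => /predU1P[[-> ->]|vw].
  by rewrite !eqxx; case: eqP => // ua; rewrite ua mem_head in up.
have vap : v \in a :: p := mem_belast (walk_tail_in vw).
have wap : w \in a :: p by rewrite inE (walk_head_in vw) orbT.
case: (u =P w) => [uw|_]; first by rewrite uw wap in up.
case: (u =P v) => [uv|_]; first by rewrite uv vap in up.
by congr _.+1; apply: IH Up vw.
Qed.

(** Where the frontier leaves a vertex by its leftmost out-edge, this reduces [drawn_outs] to an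
    equality. *)
Lemma index_le_head u w a p : w = head u p -> a \in p ->
  (index a p <= index w p) = (a == w).
Proof. by move->; case: p => //= b p _; rewrite eqxx [a == b]eq_sym; case: (b == a). Qed.

Lemma index_next p a b q : uniq (p ++ a :: b :: q) ->
  index b (p ++ a :: b :: q) = (index a (p ++ a :: b :: q)).+1.
Proof.
elim: p => [|c p IH] /= /andP[].
  by rewrite in_cons !eqxx => /norP[/negPf ->].
rewrite mem_cat !in_cons => /norP[_ /norP[/negPf-> /norP[/negPf-> _]]] U.
by rewrite IH.
Qed.

Lemma index_le_last w a p : uniq p -> a \in p -> index a p <= index (last w p) p.
Proof.
case: p => // b p Up ap; rewrite [last w _]/=.
by rewrite (index_last Up) -ltnS (index_mem a (b :: p)).
Qed.

Variable pos : V -> nat.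

Lemma walk_bounds u p d : path (relpre pos ltn) u p -> d \in walk u p ->
  [/\ pos u <= pos d.1, pos d.1 < pos d.2 & pos d.2 <= pos (last u p)].
Proof.
elim: p u => //= w p IH u /andP[uw wp].
have le_last : pos w <= pos (last w p).
  have /allP wmin := order_path_min (relpre_trans ltn_trans) wp.
  by have := mem_last w p; rewrite inE => /predU1P[->//|/wmin /ltnW].
rewrite inE => /predU1P[->/=|dp]; first by [].
by have [] := IH w wp dp; split=> //; rewrite (leq_trans (ltnW uw)).
Qed.

Lemma walk_mem_bounds u p x : path (relpre pos ltn) u p -> x \in u :: p ->
  pos u <= pos x <= pos (last u p).
Proof.
move=> up; rewrite inE => /predU1P[->|xp].
  case: p up => [|w p] up; first by rewrite leqnn.
  by have [/= *] := walk_bounds up (mem_head (u, w) _); lia.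
have [v vx] := walk_into u xp.
by have [/= *] := walk_bounds up vx; lia.
Qed.

(** Source of [right_cover] for the initial frontier and for each new right path: positions increase
    along the frontier, so its edges cannot jump over its own vertices. *)
Lemma walk_not_between u p d x : path (relpre pos ltn) u p ->
  d \in walk u p -> x \in u :: p -> ~~ (pos d.1 < pos x < pos d.2).
Proof.
elim: p u => //= w p IH u /andP[/= uw wp].
rewrite inE => /predU1P[->/=|dp]; rewrite inE => /predU1P[->|xp].
- by rewrite ltnn.
- by have := walk_mem_bounds wp xp; lia.
- by have [? ? ?] := walk_bounds wp dp; lia.
- exact: IH _ wp dp xp.
Qed.

End Walk.

(** * Alternation of tight and loose edges, and insertion into a linear order *)

Lemma path_orb_sub (I : eqType) (f g : I -> bool) (l : seq I) (i j : bool) :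
  {in l, forall d, f d -> g d} -> (i -> j) -> path orb i (map f l) ->
  path orb j (map g l) /\ (last i (map f l) -> last j (map g l)).
Proof.
elim: l i j => //= d l IH i j fg ij /andP[/orP id pl].
have fgd : f d -> g d by apply: fg; rewrite mem_head.
have fgl : {in l, forall b, f b -> g b} by move=> b bl; apply: fg; rewrite inE bl orbT.
have [-> lst] := IH _ _ fgl fgd pl; split=> //; rewrite andbT; apply/orP.
by case: id => [/ij|/fgd]; [left | right].
Qed.

(** Trouble can only arise inside the new segment or at its two junctions. At a junction, a failing
    neighbour forces the old end to satisfy [f], hence the new end to satisfy [g]. *)
Lemma sorted_orb_change (I : eqType) (f g : I -> bool) (a b b' c : seq I) (d d' : I) :
  {in a, forall k, f k -> g k} -> {in c, forall k, f k -> g k} ->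
  (f d -> g d') -> (f (last d b) -> g (last d' b')) ->
  path orb (g d') (map g b') ->
  sorted orb (map f (a ++ (d :: b) ++ c)) -> sorted orb (map g (a ++ (d' :: b') ++ c)).
Proof.
move=> fga fgc fgd fgl gb'; have sortedE l : sorted orb l = path orb true l by case: l.
rewrite !sortedE !map_cat !cat_path /= => /and3P[pa /andP[/orP ad _] pc].
have [-> lst] := path_orb_sub fga (fun x : true => x) pa.
rewrite gb' !last_map !andbT in pc *.
have [-> _] := path_orb_sub fgc fgl pc; rewrite andbT; apply/orP.
by case: ad => [/lst|/fgd]; [left | right].
Qed.

(* The vertices of W go just above their slots. *)
Lemma interleave (V : finType) (T : {set V}) (pos : V -> nat) (W : seq V) (slot : V -> V) :
  {in W, forall w, w \notin T} ->
  {in W &, forall w w', index w W < index w' W -> pos (slot w) <= pos (slot w')} ->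
  exists pos' : V -> nat,
    [/\ {in T &, forall u w, (pos' u < pos' w) = (pos u < pos w)},
        {in T & W, forall u w, (pos' u < pos' w) = (pos u <= pos (slot w))},
        {in T & W, forall u w, (pos' w < pos' u) = (pos (slot w) < pos u)}
      & {in W &, forall w w', index w W < index w' W -> pos' w < pos' w'}].
Proof.
(* Scaling old positions by [N] leaves [size W] free places above each of them; the offset
   [index + 1] fits there and never reaches the next old position. *)
move=> WT slot_le; pose N := (size W).+1.
pose pos' u := if u \in W then pos (slot u) * N + (index u W).+1 else pos u * N.
have posT u : u \in T -> pos' u = pos u * N.
  by rewrite /pos'; case: ifP => // /WT /negP.
have posW w : w \in W -> pos' w = pos (slot w) * N + (index w W).+1.
  by rewrite /pos' => ->.
have idx w : w \in W -> (index w W).+1 < N by rewrite ltnS index_mem.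
exists pos'; split.
- by move=> u w uT wT; rewrite !posT // ltn_mul2r.
- move=> u w uT wW; rewrite (posT u) // (posW w) //; move: (idx w wW).
  move: (index w W) (pos u) (pos (slot w)) => i a b iN.
  by case: (leqP a b) => ab; [have := leq_mul ab (leqnn N) | have := leq_mul ab (leqnn N)];
    rewrite ?mulSn; lia.
- move=> u w uT wW; rewrite (posT u) // (posW w) //; move: (idx w wW).
  move: (index w W) (pos u) (pos (slot w)) => i a b iN.
  by case: (ltnP b a) => ab; [have := leq_mul ab (leqnn N) | have := leq_mul ab (leqnn N)];
    rewrite ?mulSn; lia.
move=> w w' wW w'W lt_ww'; rewrite !posW //.
by rewrite -addnS leq_add ?ltnS // leq_mul // slot_le.
Qed.

(** * Sweeping the faces from left to right *)

Section Ordered.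

Variables (V : finType) (e : rel V) (s t : V) (ins outs : V -> seq V).

Definition first_in u v := e u v && (u == head v (ins v)).
Definition first_out u v := e u v && (v == head u (outs u)).
Definition last_out u v := e u v && (v == last u (outs u)).

(* The combinatorial content of a plane st-graph with the given face lengths: *)
(* [ins v] and [outs v] list the neighbours from left to right.               *)
Record ordered_st_graph : Prop := OrderedStGraph {
  mem_ins : forall v u, (u \in ins v) = e u v;
  mem_outs : forall v w, (w \in outs v) = e v w;
  uniq_ins : forall v, uniq (ins v);
  uniq_outs : forall v, uniq (outs v);
  height : exists h : V -> nat, forall u v, e u v -> h u < h v;
  source_reaches : forall v, connect e s v;
  source_in : forall u, ~~ e u s;
  sink_out : forall w, ~~ e t w;
  left_border : exists p, [/\ path first_out s p, path first_in s p & last s p = t];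
  face_right : forall v O1 y x O2, outs v = O1 ++ y :: x :: O2 ->
    exists xs z x2 ys, [/\ path last_out y (rcons xs z),
      path first_out x (rcons (x2 :: ys) z), path first_in v [:: x, x2 & ys] &
      exists I1 I2, ins z = I1 ++ last y xs :: last x2 ys :: I2]
}.

(** Only drawn vertices count: outside [T] the values of [pos] are arbitrary. *)
Definition tight (T : {set V}) (pos : V -> nat) (d : V * V) :=
  [forall v in T, ~~ (pos d.1 < pos v < pos d.2)].

(* The frontier s :: F is the right border of the part T, D (vertices, edges) *)
(* already drawn. L is the left page, and D :\: L the right one.              *)
Record sweep_state (F : seq V) (T : {set V}) (D L : {set V * V}) (pos : V -> nat)
    : Prop := SweepState {
  frontier_end : last s F = t;
  frontier_T : {subset s :: F <= T};
  frontier_D : {subset walk s F <= D};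
  drawn_edge : forall u w, (u, w) \in D -> [/\ e u w, u \in T & w \in T];
  pos_inj : {in T &, injective pos};
  pos_lt : forall u w, (u, w) \in D -> pos u < pos w;
  drawn_first : forall w, w \in T -> w != s -> (head w (ins w), w) \in D;
  drawn_outs : forall u w x, (u, w) \in walk s F -> e u x ->
    ((u, x) \in D) = (index x (outs u) <= index w (outs u));
  drawn_all : forall u x, u \in T -> u \notin s :: F -> e u x -> (u, x) \in D;
  drawn_ins : forall u w x, (u, w) \in walk s F -> (x, w) \in D ->
    index x (ins w) <= index u (ins w);
  no_two_loose : sorted orb (map (tight T pos) (walk s F));
  left_D : {subset L <= D};
  frontier_right : forall d, d \in walk s F -> d \notin L;
  right_cover : forall a b x, (a, b) \in D -> (a, b) \notin L -> x \in s :: F ->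
    ~~ (pos a < pos x < pos b);
  left_cross : forall a b c d, (a, b) \in L -> (c, d) \in L ->
    ~~ [&& pos a < pos c, pos c < pos b & pos b < pos d];
  right_cross : forall a b c d, (a, b) \in D -> (a, b) \notin L ->
    (c, d) \in D -> (c, d) \notin L ->
    ~~ [&& pos a < pos c, pos c < pos b & pos b < pos d];
  outs_sorted : forall v x y, (v, x) \in D -> (v, y) \in D ->
    index x (outs v) < index y (outs v) ->
    if (v, y) \in L then ((v, x) \in L) && (pos y < pos x)
    else ((v, x) \in L) || (pos x < pos y);
  ins_sorted : forall v x y, (x, v) \in D -> (y, v) \in D ->
    index x (ins v) < index y (ins v) ->
    if (y, v) \in L then ((x, v) \in L) && (pos x < pos y)
    else ((x, v) \in L) || (pos y < pos x)
}.

Hypothesis G : ordered_st_graph.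

Lemma uniq_increasing_path (h : V -> nat) (r : rel V) u p :
  (forall u v, e u v -> h u < h v) -> subrel r e -> path r u p -> uniq (u :: p).
Proof.
move=> he re up; apply: (@sorted_uniq _ (relpre h ltn)).
- exact: relpre_trans ltn_trans.
- by move=> w; rewrite /= ltnn.
by apply: sub_path up => a b /re /he.
Qed.

(** * One face to the right of the frontier *)

Section Step.

Variables (A C xs ys : seq V) (y z x x2 : V).
Variables (T : {set V}) (D L : {set V * V}) (pos : V -> nat).

(** The frontier follows [A] to the source [v] of the face, then its left path [B] to its sink [z],
    then [C]. The inner vertices of its right path are [W]. *)
Let v := last s A.
Let B := rcons (y :: xs) z.
Let W := [:: x, x2 & ys].
Let F := A ++ B ++ C.

Hypothesis st : sweep_state F T D L pos.
Hypothesis left_path : path last_out y (rcons xs z).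
Hypothesis right_path : path first_out x (rcons (x2 :: ys) z).
Hypothesis right_path_in : path first_in v W.
Hypothesis index_x : index x (outs v) = (index y (outs v)).+1.
Hypothesis index_z : index (last x2 ys) (ins z) = (index (last y xs) (ins z)).+1.

Lemma walkF : walk s F = walk s A ++ walk v B ++ walk z C.
Proof. by rewrite !walk_cat /B last_rcons. Qed.

Lemma pathF : path (relpre pos ltn) s F.
Proof.
by rewrite path_walk; apply/allP=> d /(frontier_D st); case: d => a b /(pos_lt st).
Qed.

Lemma pathABC : [/\ path (relpre pos ltn) s A, path (relpre pos ltn) v B
  & path (relpre pos ltn) z C].
Proof. by have := pathF; rewrite !cat_path /B last_rcons => /and3P. Qed.

Lemma memF a : a \in s :: F = [|| a \in s :: A, a \in B | a \in C].
Proof. by rewrite -!mem_cat. Qed.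

Lemma boundsA d : d \in walk s A -> pos d.1 < pos d.2 <= pos v.
Proof. by have [pA _ _] := pathABC; case/(walk_bounds pA) => _ -> ->. Qed.

Lemma boundsB d : d \in walk v B ->
  [/\ pos v <= pos d.1, pos d.1 < pos d.2 & pos d.2 <= pos z].
Proof. by have [_ pB _] := pathABC; move/(walk_bounds pB); rewrite last_rcons. Qed.

Lemma boundsC d : d \in walk z C -> pos z <= pos d.1 < pos d.2.
Proof. by have [_ _ pC] := pathABC; case/(walk_bounds pC) => -> ->. Qed.

Lemma vT : v \in T.
Proof. by apply: (frontier_T st); rewrite memF mem_last. Qed.

Lemma BT a : a \in B -> a \in T.
Proof. by move=> aB; apply: (frontier_T st); rewrite memF aB orbT. Qed.

Lemma zT : z \in T.
Proof. by apply: BT; rewrite mem_rcons mem_head. Qed.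

Lemma edge_vW : path e v (rcons W z).
Proof.
rewrite rcons_path (sub_path _ right_path_in) /=; last by move=> a b /andP[].
by move: right_path; rewrite rcons_path => /andP[_ /andP[]].
Qed.

Lemma uniq_vWz : uniq (v :: rcons W z).
Proof. by have [h he] := height G; apply: (uniq_increasing_path he (r := e)) edge_vW. Qed.

(** A drawn vertex has its leftmost in-edge drawn. For [x] this edge is [(v, x)], but the out-edges
    of [v] are drawn only up to [y]. Freshness then propagates along [W], each vertex being the
    leftmost in-neighbour of the next. *)
Lemma W_fresh w : w \in W -> w \notin T.
Proof.
have xT : x \notin T.
  have [/andP[vx /eqP xv] _] : first_in v x /\ True by split; case/andP: right_path_in.
  apply/negP=> xT; have : (v, x) \in D.
    rewrite xv; apply: (drawn_first st) xT _; apply: contraTneq vx => ->.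
    exact: source_in G _.
  by rewrite (drawn_outs st (w := y)) // ?walkF ?mem_cat ?mem_head ?orbT // index_x ltnn.
rewrite inE => /predU1P[->//|].
have : path first_in x (x2 :: ys) by case/andP: right_path_in.
elim: (x2 :: ys) x xT => //= b p IH a aT /andP[/andP[ab /eqP ai] bp].
have bT : b \notin T.
  apply: contra aT => bT; have : (a, b) \in D.
    rewrite ai; apply: (drawn_first st) bT _; apply: contraTneq ab => ->.
    exact: source_in G _.
  by case/(drawn_edge st).
by rewrite inE => /predU1P[->//|]; apply: IH bT bp.
Qed.

Lemma walkB : walk v B = (v, y) :: rcons (walk y xs) (last y xs, z).
Proof. by rewrite /B -walk_rcons. Qed.

(** Two different slots are used only if both extreme edges of the left path are tight. If neither
    is, the edge after the loose first one is tight by [no_two_loose]. *)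
Lemma slots : exists g1 g2,
  [/\ g1 \in walk v B, g2 \in walk v B, tight T pos g1, tight T pos g2 &
  [/\ tight T pos (v, y) -> g1 = (v, y),
      tight T pos (last y xs, z) -> g2 = (last y xs, z)
    & g1 = g2 \/ g1 = (v, y) /\ g2 = (last y xs, z)]].
Proof.
have Bfirst : (v, y) \in walk v B by rewrite walkB mem_head.
have Blast : (last y xs, z) \in walk v B by rewrite walkB inE mem_rcons mem_head orbT.
have [t1|nt1] := boolP (tight T pos (v, y)).
  exists (v, y); have [t2|nt2] := boolP (tight T pos (last y xs, z)).
    by exists (last y xs, z); split=> //; split=> //; right.
  by exists (v, y); split=> //; split=> //; left.
have [t2|nt2] := boolP (tight T pos (last y xs, z)).
  by exists (last y xs, z), (last y xs, z); split=> //; split=> //; left.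
have [d dB td] : exists2 d, d \in walk v B & tight T pos d.
  have := no_two_loose st; rewrite walkF !map_cat => /cat_sorted2[_ /cat_sorted2[+ _]].
  rewrite walkB; case: (walk y xs) => [|d p] /= /andP[+ _]; rewrite (negPf nt1) /= => td.
    by exists (last y xs, z); rewrite // !inE eqxx orbT.
  by exists d; rewrite // !inE eqxx orbT.
by exists d, d; split=> //; split=> //; left.
Qed.

(** * The invariant after the insertion *)

Section Insert.

Variables (g1 g2 : V * V).
Hypotheses (g1B : g1 \in walk v B) (g2B : g2 \in walk v B).
Hypotheses (g1_tight : tight T pos g1) (g2_tight : tight T pos g2).
Hypothesis first_slot : tight T pos (v, y) -> g1 = (v, y).
Hypothesis last_slot : tight T pos (last y xs, z) -> g2 = (last y xs, z).
Hypothesis slots_eq : g1 = g2 \/ g1 = (v, y) /\ g2 = (last y xs, z).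

(** The lower end of the slot edge identifies the slot, as new vertices go just above it. Only [x]
    uses the first slot; all later inner vertices use the second. *)
Let slot w := if w == x then g1.1 else g2.1.

Lemma slot_mono :
  {in W &, forall w w', index w W < index w' W -> pos (slot w) <= pos (slot w')}.
Proof.
move=> w w' _ _; rewrite /slot; have [->|_ _] := eqVneq w' x; first by rewrite /= eqxx.
case: ifP => // _; case: slots_eq => [->//|[-> _]] /=.
by have [] := boundsB g2B.
Qed.

Variable pos' : V -> nat.
Hypothesis posTT : {in T &, forall u w, (pos' u < pos' w) = (pos u < pos w)}.
Hypothesis posTW : {in T & W, forall u w, (pos' u < pos' w) = (pos u <= pos (slot w))}.
Hypothesis posWT : {in T & W, forall u w, (pos' w < pos' u) = (pos (slot w) < pos u)}.
Hypothesis posWW : {in W &, forall w w', index w W < index w' W -> pos' w < pos' w'}.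

Let N := walk v (rcons W z).
Let D' := D :|: [set d in N].
Let L' := L :|: [set g1; g2].
Let T' := T :|: [set w in W].
Let F' := A ++ rcons W z ++ C.

Lemma memT' u : (u \in T') = (u \in T) || (u \in W).
Proof. by rewrite in_setU in_set. Qed.

Lemma memD' d : (d \in D') = (d \in D) || (d \in N).
Proof. by rewrite in_setU in_set. Qed.

Lemma memL' d : (d \in L') = (d \in L) || (d \in [set g1; g2]).
Proof. by rewrite in_setU. Qed.

Lemma slot_edge g : g \in [set g1; g2] -> g \in walk v B /\ tight T pos g.
Proof. by case/set2P=> ->. Qed.

Lemma slotP w : exists2 g, g \in [set g1; g2] & slot w = g.1.
Proof.
by rewrite /slot; case: ifP => _; [exists g1 | exists g2]; rewrite // !inE eqxx ?orbT.
Qed.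

Lemma slot_bounds w : pos v <= pos (slot w) < pos z.
Proof.
have [g /slot_edge[/boundsB[h1 h2 h3] _] ->] := slotP w.
by rewrite h1 (leq_trans h2).
Qed.

Lemma slot_ends g : g \in [set g1; g2] -> [/\ g.1 \in T, g.2 \in T, g.1 \in s :: F,
  g.2 \in s :: F & g \in walk s F].
Proof.
case/slot_edge=> gB _; have gF : g \in walk s F by rewrite walkF !mem_cat gB orbT.
have g1F : g.1 \in s :: F by exact: mem_belast (walk_tail_in gF).
have g2F : g.2 \in s :: F by rewrite inE (walk_head_in gF) orbT.
by split=> //; apply: (frontier_T st).
Qed.

Lemma uniqW : uniq W.
Proof. by have := uniq_vWz; rewrite cons_uniq rcons_uniq => /and3P[]. Qed.

Lemma walkN : N = (v, x) :: rcons (walk x (x2 :: ys)) (last x2 ys, z).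
Proof. by rewrite /N walk_rcons. Qed.

Lemma lastW : last x2 ys \in W.
Proof. by rewrite inE mem_last orbT. Qed.

Lemma N_cases a b : (a, b) \in N -> [\/ a = v /\ b = x,
  [/\ a \in W, b \in W & index b W = (index a W).+1] | a = last x2 ys /\ b = z].
Proof.
rewrite walkN inE mem_rcons inE => /predU1P[[-> ->]|/predU1P[[-> ->]|ab]].
- exact: Or31.
- exact: Or33.
apply: Or32; rewrite (walk_index uniqW ab); split=> //.
  exact: mem_belast (walk_tail_in ab).
by rewrite inE (walk_head_in ab) orbT.
Qed.

Lemma N_first : (v, x) \in N.
Proof. by rewrite walkN mem_head. Qed.

Lemma N_last : (last x2 ys, z) \in N.
Proof. by rewrite walkN inE mem_rcons mem_head orbT. Qed.

Lemma N_inj1 a b b' : (a, b) \in N -> (a, b') \in N -> b = b'.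
Proof. exact: walk_inj1 uniq_vWz. Qed.

Lemma N_inj2 a a' b : (a, b) \in N -> (a', b) \in N -> a = a'.
Proof. by apply: walk_inj2; have /andP[] := uniq_vWz. Qed.

Lemma N_edge a b : (a, b) \in N -> e a b.
Proof. by move: edge_vW; rewrite path_walk => /allP/[apply]. Qed.

Lemma W_notT a : a \in W -> a \in T -> False.
Proof. by move/W_fresh/negP. Qed.

Lemma N_not_D d : d \in N -> d \notin D.
Proof.
case: d => a b /N_cases ab; apply/negP=> /(drawn_edge st)[_ aT bT].
case: ab => [[_ bx]|[aW _ _]|[aW _]]; first by apply: (@W_notT b); rewrite // bx mem_head.
  exact: W_notT aW aT.
by apply: (@W_notT a); rewrite // aW lastW.
Qed.

Lemma D'_tailT a b : (a, b) \in D' -> a \in T -> (a, b) \in D \/ a = v /\ b = x.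
Proof.
rewrite memD' => /orP[|/N_cases[|[aW _ _]|[aW _]]] aT; [by left | by right | |].
  by case: (W_notT aW aT).
by case: (@W_notT a); rewrite // aW lastW.
Qed.

Lemma D'_headT a b : (a, b) \in D' -> b \in T ->
  (a, b) \in D \/ a = last x2 ys /\ b = z.
Proof.
rewrite memD' => /orP[|/N_cases[[_ bx]|[_ bW _]|]] bT; [by left | | | by right].
  by case: (@W_notT b); rewrite // bx mem_head.
by case: (W_notT bW bT).
Qed.

Lemma D'_tailW a b : (a, b) \in D' -> a \in W -> (a, b) \in N.
Proof. by rewrite memD' => /orP[/(drawn_edge st)[_ aT _] /W_notT|]. Qed.

Lemma D'_headW a b : (a, b) \in D' -> b \in W -> (a, b) \in N.
Proof. by rewrite memD' => /orP[/(drawn_edge st)[_ _ bT] /W_notT|]. Qed.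

Lemma pos'_lt a b : (a, b) \in D' -> pos' a < pos' b.
Proof.
rewrite memD' => /orP[/[dup] /(drawn_edge st)[_ aT bT] /(pos_lt st)|].
  by rewrite posTT.
case/N_cases=> [[-> ->]|[aW bW ab]|[-> ->]].
- by rewrite posTW ?vT ?mem_head //; case/andP: (slot_bounds x).
- by rewrite posWW // ab.
by rewrite posWT ?zT ?lastW //; case/andP: (slot_bounds (last x2 ys)).
Qed.

Lemma pos'_inj : {in T' &, injective pos'}.
Proof.
have neq a b : (pos' a < pos' b) || (pos' b < pos' a) -> pos' a <> pos' b.
  by move=> + eq_ab; rewrite eq_ab ltnn.
have TW a b : a \in T -> b \in W -> pos' a <> pos' b.
  by move=> aT bW; apply: neq; rewrite posTW // posWT // leqVgt.
move=> a b; rewrite !memT' => /orP[aT|aW] /orP[bT|bW] eq_ab.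
- case: (ltngtP (pos a) (pos b)) => [lt|gt|].
  + by rewrite -posTT // eq_ab ltnn in lt.
  + by rewrite -posTT // eq_ab ltnn in gt.
  exact: (pos_inj st aT bT).
- by case: (TW a b).
- by case: (TW b a).
have := neq a b; case: (ltngtP (index a W) (index b W)) => [lt|gt|/index_inj-> //].
  by rewrite (posWW aW bW lt) => /(_ isT).
by rewrite (posWW bW aW gt) orbT => /(_ isT).
Qed.

Lemma walkF' : walk s F' = walk s A ++ N ++ walk z C.
Proof. by rewrite !walk_cat last_rcons. Qed.

Lemma frontier_D' : {subset walk s F' <= D'}.
Proof.
move=> d; rewrite walkF' memD' !mem_cat orbCA orbC => /orP[dAC|->]; last by rewrite orbT.
by rewrite (frontier_D st) // walkF !mem_cat; case/orP: dAC => ->; rewrite ?orbT.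
Qed.

Lemma pathF' : path (relpre pos' ltn) s F'.
Proof. by rewrite path_walk; apply/allP=> -[a b] /frontier_D' /pos'_lt. Qed.

Lemma memF' a : a \in s :: F' = [|| a \in s :: A, a \in W, a == z | a \in C].
Proof. by rewrite -cat_cons !mem_cat mem_rcons (in_cons z W); case: (a == z); rewrite ?orbT. Qed.

Lemma memF'_old a : a \in s :: F' -> a \notin W -> a \in s :: F.
Proof.
rewrite memF' memF => /or4P[->|->|/eqP->|->] //; rewrite ?orbT //.
by rewrite mem_rcons mem_head orbT.
Qed.

(** An old right edge over a new vertex in slot [g] starts at or below [g.1] and ends above it.
    Neither end of [g] may be strictly covered, so the edge starts at [g.1] and ends at or below
    [g.2]; by tightness it is [g] itself, which has moved to the left page. *)
Lemma cover' a b w : (a, b) \in D' -> (a, b) \notin L' -> w \in s :: F' ->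
  ~~ (pos' a < pos' w < pos' b).
Proof.
rewrite memD' => /orP[abD|abN _ wF]; last first.
  apply: (walk_not_between pathF' _ wF (d := (a, b))).
  by rewrite walkF' !mem_cat abN orbT.
rewrite memL' negb_or => /andP[abL abg] wF.
have [_ aT bT] := drawn_edge st abD.
have [wW|wW] := boolP (w \in W); last first.
  have wF0 := memF'_old wF wW; have wT := frontier_T st wF0.
  by rewrite !posTT //; apply: (right_cover st).
rewrite posTW // posWT //; have [g gg ->] := slotP w.
have [g1T g2T g1F g2F gF] := slot_ends gg; have [_ /forall_inP/(_ b bT) gt] := slot_edge gg.
have lt_g : pos g.1 < pos g.2.
  by apply: (pos_lt st); rewrite -surjective_pairing (frontier_D st).
apply/negP=> /andP[le_ag lt_gb].
have := right_cover st abD abL g1F; rewrite lt_gb andbT -leqNgt => le_ga.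
have eq_ag : a = g.1 by apply: (pos_inj st aT g1T); apply/eqP; rewrite eqn_leq le_ag.
have := right_cover st abD abL g2F; rewrite eq_ag lt_g -leqNgt /= => le_bg.
move: gt; rewrite lt_gb -leqNgt /= => le_gb.
have eq_bg : b = g.2 by apply: (pos_inj st bT g2T); apply/eqP; rewrite eqn_leq le_bg.
by move: abg; rewrite eq_ag eq_bg -surjective_pairing gg.
Qed.

Lemma tight_between g b : tight T pos g -> b \in T -> pos g.1 < pos b -> pos g.2 <= pos b.
Proof. by move=> /forall_inP/(_ b)/[apply] + gb; rewrite gb -leqNgt. Qed.

(** All new vertices lie between [v] and [z], while edges of [A] end at or below [v] and those of
    [C] start at or above [z]. *)
Lemma tight_keep d : d \in walk s A \/ d \in walk z C ->
  tight T pos d -> tight T' pos' d.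
Proof.
move=> dAC; have dD : d \in D.
  by apply: (frontier_D st); rewrite walkF !mem_cat; case: dAC => ->; rewrite ?orbT.
have [_ d1T d2T] : [/\ e d.1 d.2, d.1 \in T & d.2 \in T].
  by apply: (drawn_edge st); rewrite -surjective_pairing.
move=> /forall_inP dt; apply/forall_inP=> w; rewrite memT' => /orP[wT|wW].
  by rewrite !posTT //; apply: dt.
rewrite posTW // posWT //; have /andP[lo hi] := slot_bounds w.
case: dAC => [/boundsA/andP[_ dv]|/boundsC/andP[zd _]].
  by rewrite negb_and -leqNgt (leq_trans dv lo) orbT.
by rewrite negb_and -ltnNge (leq_trans hi zd).
Qed.

(** If [(v, y)] is tight it is the first slot, so [x] is placed immediately above [v]. *)
Lemma tight_first : tight T pos (v, y) -> tight T' pos' (v, x).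
Proof.
move=> vy_tight; apply/forall_inP=> w; rewrite memT' => /orP[wT|wW] /=.
  have -> : pos' w < pos' x = (pos w <= pos v).
    by rewrite posTW ?mem_head // /slot eqxx first_slot.
  by rewrite posTT ?vT // ltnNge andNb.
rewrite negb_and -!leqNgt; apply/orP; right.
have [->|wx] := eqVneq w x; first by [].
by apply/ltnW/posWW => //=; rewrite ?mem_head // eqxx eq_sym (negPf wx).
Qed.

Lemma tight_last : tight T pos (last y xs, z) -> tight T' pos' (last x2 ys, z).
Proof.
move=> t_last; have slotE : slot (last x2 ys) = last y xs.
  (* Since [x2] exists, the last inner vertex differs from [x] and lies in the second slot. *)
  rewrite /slot ifN ?last_slot //.
  have /andP[xW _] := uniqW; apply: contra xW => /eqP<-; exact: mem_last.
have zT' := zT; have lW := lastW.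
apply/forall_inP=> w; rewrite memT' => /orP[wT|wW] /=.
  rewrite posWT // posTT // slotE.
  by have /forall_inP/(_ w wT) := t_last.
rewrite negb_and -!leqNgt; apply/orP; left.
rewrite leqNgt; apply/negP=> lt_w; have := index_mem w W; rewrite wW.
have idx : index (last x2 ys) W = size (x2 :: ys) by apply: index_last uniqW.
have [lt|le] := ltnP (index (last x2 ys) W) (index w W).
  by rewrite idx in lt; rewrite ltnNge lt.
have [eq_w|ne_w] := eqVneq w (last x2 ys); first by rewrite eq_w ltnn in lt_w.
have : index w W < index (last x2 ys) W.
  rewrite ltn_neqAle le andbT; apply: contra ne_w => /eqP/index_inj-> //.
by move/(posWW wW lW)/(ltn_trans lt_w); rewrite ltnn.
Qed.

(** No old vertex separates two vertices of one slot, and no new vertex lies between neighbours in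
    [W]. *)
Lemma tight_inner a b : (a, b) \in N -> a \in W -> b \in W -> slot a = slot b ->
  tight T' pos' (a, b).
Proof.
move=> ab aW bW eq_slot; have idx : index b W = (index a W).+1.
  case/N_cases: ab => [[av _]|[]//|[_ bz]].
    by case: (W_notT aW); rewrite av vT.
  by case: (W_notT bW); rewrite bz zT.
apply/forall_inP=> w; rewrite memT' => /orP[wT|wW] /=.
  by rewrite posWT // posTW // eq_slot ltnNge andNb.
rewrite negb_and -!leqNgt.
have [lt|le] := ltnP (index a W) (index w W).
  have [<-|ne] := eqVneq b w; first by rewrite leqnn orbT.
  apply/orP; right; apply/ltnW/posWW => //; rewrite idx ltn_neqAle lt andbT -idx.
  by apply: contra ne => /eqP/index_inj->.
have [->|ne] := eqVneq a w; first by rewrite leqnn.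
apply/orP; left; apply/ltnW/posWW => //; rewrite ltn_neqAle le andbT.
by apply: contra ne => /eqP/index_inj->.
Qed.

(** With one slot, all edges between new vertices are tight; only the two end edges of the right
    path may be loose, and [(x, x2)] keeps them apart. With two slots, both end edges are tight and
    only [(x, x2)] may be loose. Either way a second inner vertex is needed. *)
Lemma no_two_loose' : sorted orb (map (tight T' pos') (walk s F')).
Proof.
have := no_two_loose st; rewrite walkF walkF' walkB walkN.
apply: sorted_orb_change => [d dA|d dC| | |].
- by apply: tight_keep; left.
- by apply: tight_keep; right.
- exact: tight_first.
- by rewrite !last_rcons; apply: tight_last.
have xW : x \in W by rewrite mem_head.
have x2W : x2 \in W by rewrite !inE eqxx orbT.
rewrite /= map_rcons; apply/andP; split.
  case: slots_eq => [eq_g|[g1E g2E]].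
    rewrite orbC tight_inner //; first by rewrite walkN !inE eqxx orbT.
    by rewrite /slot; case: ifP; case: ifP => // _ _; rewrite eq_g.
  by rewrite tight_first // -g1E.
have ys_tight : all id (map (tight T' pos') (walk x2 ys)).
  rewrite all_map; apply/allP=> -[a b] ab.
  have a2 : a \in x2 :: ys := mem_belast (walk_tail_in ab).
  have b2 : b \in x2 :: ys by rewrite inE (walk_head_in ab) orbT.
  have /andP[xW' _] := uniqW.
  apply: tight_inner; rewrite ?(in_cons x (x2 :: ys)) ?a2 ?b2 ?orbT //.
    by rewrite walkN !(inE, mem_rcons) ab !orbT.
  by rewrite /slot !ifN //; apply: contraNneq xW' => <-.
have last_t : last (tight T' pos' (x, x2)) (map (tight T' pos') (walk x2 ys))
    || tight T' pos' (last x2 ys, z).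
  case: slots_eq => [eq_g|[g1E g2E]]; last by rewrite tight_last ?orbT // -g2E.
  suff -> : tight T' pos' (x, x2).
    by elim: (map _ _) ys_tight => //= b l IH /andP[->]; apply: IH.
  apply: tight_inner => //; first by rewrite walkN !inE eqxx orbT.
  by rewrite /slot; case: ifP; case: ifP => // _ _; rewrite eq_g.
rewrite rcons_path last_t andbT.
by elim: (map _ _) (tight _ _ _) ys_tight => //= b l IH i /andP[->]; rewrite orbT; apply: IH.
Qed.

Lemma left_old d : d \in L' -> d \in D.
Proof.
by rewrite memL' => /orP[/(left_D st)|/slot_ends[_ _ _ _ /(frontier_D st)]].
Qed.

Lemma frontier_right' d : d \in walk s F' -> d \notin L'.
Proof.
rewrite walkF' !mem_cat orbCA => /orP[/N_not_D|dAC]; first exact: contra (@left_old d).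
have dF : d \in walk s F by rewrite walkF !mem_cat; case/orP: dAC => ->; rewrite ?orbT.
rewrite memL' negb_or (frontier_right st dF); apply/negP=> /slot_edge[/boundsB[lo lt hi] _].
case/orP: dAC => [/boundsA|/boundsC] /andP[h1 h2].
  by move: (leq_trans h1 h2); rewrite ltnNge lo.
by move: (leq_trans lt hi); rewrite ltnNge h1.
Qed.

(** All left edges have old ends, and a moved edge is tight, so no such end lies strictly inside
    it. *)
Lemma left_cross' a b c d : (a, b) \in L' -> (c, d) \in L' ->
  ~~ [&& pos' a < pos' c, pos' c < pos' b & pos' b < pos' d].
Proof.
move=> abL cdL.
have [_ aT bT] := drawn_edge st (left_old abL).
have [_ cT dT] := drawn_edge st (left_old cdL).
rewrite !posTT //; apply/and3P=> -[ac cb bd].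
move: abL cdL; rewrite !memL' => /orP[abL|/slot_edge[_ gt]]; last first.
  by have := tight_between gt cT ac; rewrite leqNgt cb.
move=> /orP[cdL|/slot_edge[_ gt]].
  by have /negP[] := left_cross st abL cdL; rewrite ac cb bd.
by have := tight_between gt bT cb; rewrite leqNgt bd.
Qed.

(** A new edge has both ends on the frontier, so a crossing with it would contradict [cover']. *)
Lemma right_cross' a b c d : (a, b) \in D' -> (a, b) \notin L' ->
  (c, d) \in D' -> (c, d) \notin L' ->
  ~~ [&& pos' a < pos' c, pos' c < pos' b & pos' b < pos' d].
Proof.
move=> abD abL cdD cdL; apply/and3P=> -[ac cb bd].
have N_F' f : f \in N -> f.1 \in s :: F' /\ f.2 \in s :: F'.
  move=> fN; have fF : f \in walk s F' by rewrite walkF' !mem_cat fN orbT.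
  by rewrite (in_cons s F' f.2) (walk_head_in fF) orbT (mem_belast (walk_tail_in fF)).
move: (abD) (cdD); rewrite !memD' => /orP[abD0|/N_F'[_ bF] _]; last first.
  by have := cover' cdD cdL bF; rewrite cb bd.
case/orP=> [cdD0|/N_F'[cF _]]; last by have := cover' abD abL cF; rewrite ac cb.
have [_ aT bT] := drawn_edge st abD0; have [_ cT dT] := drawn_edge st cdD0.
move: abL cdL ac cb bd; rewrite !posTT // !memL'.
move=> /norP[abL _] /norP[cdL _] ac cb bd.
by have := right_cross st abD0 abL cdD0 cdL; rewrite ac cb bd.
Qed.

Lemma N_first_out a b : (a, b) \in N -> a \in W -> b = head a (outs a).
Proof.
rewrite walkN -walk_rcons inE => /predU1P[[-> _]|ab _]; first by move/W_notT/(_ vT).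
by move: right_path; rewrite path_walk => /allP/(_ _ ab)/andP[_ /eqP].
Qed.

Lemma drawn_outs' u w a : (u, w) \in walk s F' -> e u a ->
  ((u, a) \in D') = (index a (outs u) <= index w (outs u)).
Proof.
move=> uw ua; have aout : a \in outs u by rewrite (mem_outs G).
have posvz : pos v < pos z by have /andP[] := slot_bounds x; apply: leq_ltn_trans.
move: uw; rewrite walkF' !mem_cat orbCA => /orP[uwN|uwAC]; last first.
  have uwF : (u, w) \in walk s F.
    by rewrite walkF !mem_cat; case/orP: uwAC => ->; rewrite ?orbT.
  have [_ uT _] := drawn_edge st (frontier_D st uwF).
  rewrite -(drawn_outs st uwF ua); apply/idP/idP; last by rewrite memD' => ->.
  case/D'_tailT=> // -[uv _]; rewrite uv in uwAC.
  case/orP: uwAC => [/boundsA|/boundsC] /andP[/= lo hi].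
    by move: (leq_trans lo hi); rewrite ltnn.
  by move: posvz; rewrite ltnNge lo.
have [uW|uW] := boolP (u \in W).
  rewrite (index_le_head (N_first_out uwN uW) aout).
  apply/idP/eqP => [/D'_tailW/(_ uW)/(N_inj1 uwN)->//|->].
  by rewrite memD' uwN orbT.
have [[uv wx]|[]|[ul _]] := N_cases uwN; last first.
- by rewrite ul lastW in uW.
- by rewrite (negPf uW).
(* At [v] the drawn out-edges grow by exactly one, from [y] to its successor [x]. *)
rewrite uv wx index_x in ua aout *.
have vyF : (v, y) \in walk s F by rewrite walkF !mem_cat walkB mem_head orbT.
rewrite leq_eqVlt ltnS -(drawn_outs st vyF ua).
apply/idP/orP => [/D'_tailT/(_ vT)[|[_ ->]]|[/eqP ax|vaD]];
  [by right | by left; rewrite index_x | |].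
  have xout : x \in outs v by rewrite (mem_outs G) (N_edge N_first).
  by rewrite (index_inj v aout xout (etrans ax (esym index_x))) memD' N_first orbT.
by rewrite memD' vaD.
Qed.

(** The vertices that leave the frontier are inner vertices of the left path, where the frontier
    edge is the rightmost out-edge. *)
Lemma drawn_all' u a : u \in T' -> u \notin s :: F' -> e u a -> (u, a) \in D'.
Proof.
rewrite memF' memT' => uT /norP[uA /norP[uW /norP[uz uC]]] ua.
have {}uT : u \in T by rewrite (negPf uW) orbF in uT.
rewrite memD'; apply/orP; left.
have [uF|uF] := boolP (u \in s :: F); last exact: (drawn_all st).
move: uF; rewrite memF (negPf uA) (negPf uC) orbF mem_rcons in_cons (negPf uz) /= => uB.
have [w uw] : exists w, (u, w) \in walk y (rcons xs z).
  by apply: walk_from; rewrite belast_rcons.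
have uwF : (u, w) \in walk s F.
  by rewrite walkF !mem_cat walkB -walk_rcons inE uw !orbT.
rewrite (drawn_outs st uwF ua).
move: left_path; rewrite path_walk => /allP/(_ _ uw)/andP[_ /= /eqP->].
by apply: index_le_last; [apply: (uniq_outs G) | rewrite (mem_outs G)].
Qed.

Lemma drawn_ins' u w a : (u, w) \in walk s F' -> (a, w) \in D' ->
  index a (ins w) <= index u (ins w).
Proof.
move=> uw aw.
have posvz : pos v < pos z by have /andP[] := slot_bounds x; apply: leq_ltn_trans.
move: uw; rewrite walkF' !mem_cat orbCA => /orP[uwN|uwAC]; last first.
  have uwF : (u, w) \in walk s F.
    by rewrite walkF !mem_cat; case/orP: uwAC => ->; rewrite ?orbT.
  have [_ _ wT] := drawn_edge st (frontier_D st uwF).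
  case/D'_headT: aw => // [|[_ wz]]; first exact: (drawn_ins st).
  rewrite wz in uwAC.
  case/orP: uwAC => [/boundsA|/boundsC] /andP[/= lo hi].
    by move: posvz; rewrite ltnNge hi.
  by move: (leq_ltn_trans lo hi); rewrite ltnn.
have [wW|wW] := boolP (w \in W); first by rewrite (N_inj2 (D'_headW aw wW) uwN).
have [[_ wx]|[_ wW' _]|[-> wz]] := N_cases uwN.
- by rewrite wx mem_head in wW.
- by rewrite wW' in wW.
rewrite wz in aw *; have [awD|[-> _]//] := D'_headT aw zT.
rewrite index_z ltnW // ltnS; apply: (drawn_ins st) awD.
by rewrite walkF !mem_cat walkB inE mem_rcons mem_head !orbT.
Qed.

Lemma drawn_first' w : w \in T' -> w != s -> (head w (ins w), w) \in D'.
Proof.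
rewrite memT' memD' => /orP[wT ws|wW _]; first by rewrite (drawn_first st).
have [u uw] := walk_into v wW.
move: right_path_in; rewrite path_walk => /allP/(_ _ uw)/andP[_ /= /eqP <-].
by rewrite /N walk_rcons mem_rcons inE uw !orbT.
Qed.

(** The new edge [(v, x)] comes last at [v], and a right out-edge of [v] reaching beyond [x] would
    pass over it. A moved edge [(u, b)] is tight, so any other drawn out-neighbour of [u] is higher
    than [b]; an edge to the left of it that was on the right page would have to end lower. *)
Lemma outs_sorted' u a b : (u, a) \in D' -> (u, b) \in D' ->
  index a (outs u) < index b (outs u) ->
  if (u, b) \in L' then ((u, a) \in L') && (pos' b < pos' a)
  else ((u, a) \in L') || (pos' a < pos' b).
Proof.
move=> ua ub ab; have neq_ab : b != a by apply: contraTneq ab => ->; rewrite ltnn.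
have vyF : (v, y) \in walk s F by rewrite walkF !mem_cat walkB mem_head orbT.
have [uW|uW] := boolP (u \in W).
  by rewrite (N_inj1 (D'_tailW ua uW) (D'_tailW ub uW)) eqxx in neq_ab.
have uT : u \in T.
  move: ua; rewrite memD' => /orP[/(drawn_edge st)[]//|/N_cases[[->]|[]|[ul]]].
  - by rewrite vT.
  - by rewrite (negPf uW).
  by rewrite ul lastW in uW.
have [uaD|[uv ax]] := D'_tailT ua uT; last first.
  have [ubD|[_ bx]] := D'_tailT ub uT; last by rewrite ax bx eqxx in neq_ab.
  rewrite uv ax in ubD ab; have [vb _ _] := drawn_edge st ubD.
  move: ubD; rewrite (drawn_outs st vyF vb) => leb; move: ab.
  by rewrite index_x ltnNge (leq_trans leb).
have [_ _ aT] := drawn_edge st uaD.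
have [ubD|[uv bx]] := D'_tailT ub uT; last first.
  have -> : ((u, b) \in L') = false.
    by apply: contraTF N_first => /left_old; rewrite uv bx; apply/contraL/N_not_D.
  have [//|uaL] := boolP ((u, a) \in L'); rewrite /= bx.
  have xF : x \in s :: F' by rewrite memF' mem_head orbT.
  have := cover' ua uaL xF; rewrite {1}uv (pos'_lt (a := v)); last by rewrite memD' N_first orbT.
  rewrite -leqNgt leq_eqVlt /= => /orP[/eqP eq_ax|//].
  have ax : a = x by apply: pos'_inj eq_ax; rewrite memT' ?aT ?mem_head ?orbT.
  by rewrite ax bx eqxx in neq_ab.
have [_ _ bT] := drawn_edge st ubD; rewrite !posTT //.
have := outs_sorted st uaD ubD ab; rewrite !memL'; have [ubL|ubL] := boolP ((u, b) \in L).
  by case/andP=> -> ->.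
move=> sorted_ab; case: ifP => [/= ubg|_]; last by case/orP: sorted_ab => ->; rewrite ?orbT.
have [_ _ _ bF _] := slot_ends ubg; have [_ gt] := slot_edge ubg.
have lt_ba : pos b < pos a.
  have := tight_between gt aT (pos_lt st uaD); rewrite leq_eqVlt /=.
  by case/orP=> // /eqP/(pos_inj st bT aT) eq_ba; rewrite eq_ba eqxx in neq_ab.
rewrite lt_ba andbT; case/orP: sorted_ab => [->//|lt_ab].
by move: lt_ab; rewrite ltnNge (ltnW lt_ba).
Qed.

(** The mirror image of [outs_sorted'], at [z] and its new in-neighbour [last x2 ys]. *)
Lemma ins_sorted' u a b : (a, u) \in D' -> (b, u) \in D' ->
  index a (ins u) < index b (ins u) ->
  if (b, u) \in L' then ((a, u) \in L') && (pos' a < pos' b)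
  else ((a, u) \in L') || (pos' b < pos' a).
Proof.
move=> au bu ab; have neq_ab : b != a by apply: contraTneq ab => ->; rewrite ltnn.
have lzF : (last y xs, z) \in walk s F.
  by rewrite walkF !mem_cat walkB inE mem_rcons mem_head !orbT.
have [uW|uW] := boolP (u \in W).
  by rewrite (N_inj2 (D'_headW au uW) (D'_headW bu uW)) eqxx in neq_ab.
have uT : u \in T.
  move: au; rewrite memD' => /orP[/(drawn_edge st)[]//|/N_cases[[_ ux]|[]|[_ ->]]].
  - by rewrite ux mem_head in uW.
  - by rewrite (negPf uW).
  exact: zT.
have [auD|[al uz]] := D'_headT au uT; last first.
  have [buD|[bl _]] := D'_headT bu uT; last by rewrite al bl eqxx in neq_ab.
  rewrite uz al in buD ab; move: ab.
  by rewrite index_z ltnNge (leq_trans (drawn_ins st lzF buD)).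
have [_ aT _] := drawn_edge st auD.
have [buD|[bl uz]] := D'_headT bu uT; last first.
  have -> : ((b, u) \in L') = false.
    by apply: contraTF N_last => /left_old; rewrite uz bl; apply/contraL/N_not_D.
  have [//|auL] := boolP ((a, u) \in L'); rewrite /= bl.
  have lF : last x2 ys \in s :: F' by rewrite memF' lastW orbT.
  have := cover' au auL lF; rewrite {1}uz (pos'_lt (b := z)) ?andbT; last first.
    by rewrite memD' N_last orbT.
  rewrite -leqNgt leq_eqVlt /= => /orP[/eqP eq_la|//].
  have la : last x2 ys = a by apply: pos'_inj eq_la; rewrite memT' ?aT ?lastW ?orbT.
  by rewrite bl la eqxx in neq_ab.
have [_ bT _] := drawn_edge st buD; rewrite !posTT //.
have := ins_sorted st auD buD ab; rewrite !memL'; have [buL|buL] := boolP ((b, u) \in L).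
  by case/andP=> -> ->.
move=> sorted_ab; case: ifP => [/= bug|_]; last by case/orP: sorted_ab => ->; rewrite ?orbT.
have [_ _ bF _ _] := slot_ends bug; have [_ /forall_inP/(_ a aT)] := slot_edge bug.
rewrite (pos_lt st auD) andbT -leqNgt leq_eqVlt /= => lt_ab.
have {}lt_ab : pos a < pos b.
  case/orP: lt_ab => // /eqP/(pos_inj st aT bT) eq_ab.
  by rewrite eq_ab eqxx in neq_ab.
rewrite lt_ab andbT; case/orP: sorted_ab => [->//|lt_ba].
by move: lt_ba; rewrite ltnNge (ltnW lt_ab).
Qed.

Lemma sweep_insert : sweep_state F' T' D' L' pos'.
Proof.
split.
- by rewrite last_cat last_cat last_rcons; have := frontier_end st; rewrite !last_cat last_rcons.
- move=> a aF; rewrite memT'; have [//|aW] := boolP (a \in W); first by rewrite orbT.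
  by rewrite (frontier_T st) // memF'_old.
- exact: frontier_D'.
- move=> u w; rewrite memD' !memT' => /orP[/(drawn_edge st)[-> -> ->]//|uw].
  rewrite (N_edge uw); case/N_cases: uw => [[-> ->]|[-> -> _]|[-> ->]].
  + by rewrite vT mem_head orbT.
  + by rewrite !orbT.
  + by rewrite lastW zT orbT.
- exact: pos'_inj.
- exact: pos'_lt.
- exact: drawn_first'.
- exact: drawn_outs'.
- exact: drawn_all'.
- exact: drawn_ins'.
- exact: no_two_loose'.
- by move=> d /left_old; rewrite memD' => ->.
- exact: frontier_right'.
- exact: cover'.
- exact: left_cross'.
- exact: right_cross'.
- exact: outs_sorted'.
- exact: ins_sorted'.
Qed.

End Insert.

Lemma sweep_face : exists F1 T1 D1 L1 pos1,
  sweep_state F1 T1 D1 L1 pos1 /\ #|D| < #|D1|.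
Proof.
have [g1 [g2 [g1B g2B t1 t2 [first_slot last_slot slots_eq]]]] := slots.
have WT : {in W, forall w, w \notin T} by exact: W_fresh.
have [pos' [TT TW WT' WW]] := interleave WT (slot_mono g2B slots_eq).
have st' := sweep_insert g1B g2B t1 t2 first_slot last_slot slots_eq TT TW WT' WW.
do 5!eexists; split; first exact: st'.
apply/proper_card/properP; split; first exact: subsetUl.
exists (v, x); first by rewrite in_setU in_set N_first orbT.
by apply: N_not_D; apply: N_first.
Qed.

End Step.

(** * Running the sweep from the left border to completion *)

Lemma sweep_start : exists F T D L pos, sweep_state F T D L pos.
Proof.
have [p [pout pin plast]] := left_border G; have [h he] := height G.
have Up : uniq (s :: p) by apply: (uniq_increasing_path he _ pout) => a b /andP[].
(* The spine order is that of the leftmost path itself, so every edge starts out tight and on the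
   right page. *)
pose F0 := s :: p; pose pos a := index a F0.
have first_out_p a b : (a, b) \in walk s p -> b = head a (outs a).
  by move: pout; rewrite path_walk => /allP/[apply]/andP[_ /eqP].
have first_in_p a b : (a, b) \in walk s p -> a = head b (ins b).
  by move: pin; rewrite path_walk => /allP/[apply]/andP[_ /eqP].
have edge_p a b : (a, b) \in walk s p -> e a b.
  by move: pout; rewrite path_walk => /allP/[apply]/andP[].
have inj1 a b b' : (a, b) \in walk s p -> (a, b') \in walk s p -> b = b' := walk_inj1 Up.
have inj2 a a' b : (a, b) \in walk s p -> (a', b) \in walk s p -> a = a'.
  by apply: walk_inj2; case/andP: Up.
exists p, [set a in F0], [set d in walk s p], set0, pos.
have p_lt a b : (a, b) \in walk s p -> pos a < pos b.
  by rewrite /pos => /(walk_index Up) ->.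
have p_path : path (relpre pos ltn) s p by rewrite path_walk; apply/allP=> -[a b] /p_lt.
split=> //.
- by move=> a ap; rewrite in_set.
- by move=> d dp; rewrite in_set.
- move=> a b; rewrite !in_set => ab; rewrite (edge_p a b ab); split=> //.
    exact: mem_belast (walk_tail_in ab).
  by rewrite /F0 in_cons (walk_head_in ab) orbT.
- by move=> a b; rewrite !in_set => aF bF; apply: (index_inj s aF bF).
- by move=> a b; rewrite in_set; apply: p_lt.
- move=> a; rewrite in_set in_cons => /orP[->//|ap _].
  by have [b ba] := walk_into s ap; rewrite in_set -(first_in_p b).
- move=> a b c ab ac; rewrite in_set.
  have cout : c \in outs a by rewrite (mem_outs G).
  rewrite (index_le_head (first_out_p a b ab) cout).
  by apply/idP/eqP => [/(inj1 _ _ _ ab)->|->].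
- by move=> a b; rewrite in_set => ->.
- by move=> a b c ab; rewrite in_set => cb; rewrite (inj2 _ _ _ ab cb).
- have all_tight : {in walk s p, forall d, tight [set a in F0] pos d}.
    by move=> d dp; apply/forall_inP=> a; rewrite in_set; apply: walk_not_between dp.
  elim: (walk s p) all_tight => //= d l IH dl.
  have {}IH := IH (fun b bl => dl b (mem_behead (s := d :: l) bl)).
  by case: l dl IH => //= b l dl ->; rewrite dl ?mem_head.
- by move=> d; rewrite in_set0.
- by move=> d _; rewrite in_set0.
- by move=> a b c; rewrite in_set => ab _; apply: walk_not_between ab.
- by move=> a b c d; rewrite in_set0.
- move=> a b c d; rewrite !in_set => ab _ cd _; apply/and3P=> -[ac cb bd].
  have cF : c \in s :: p := mem_belast (walk_tail_in cd).
  by have := walk_not_between p_path ab cF; rewrite ac cb.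
- by move=> a b c; rewrite !in_set => ab ac; rewrite (inj1 _ _ _ ab ac) ltnn.
- by move=> a b c; rewrite !in_set => ba ca; rewrite (inj2 _ _ _ ba ca) ltnn.
Qed.

Lemma last_bad_edge (r : rel V) u p : ~~ path r u p ->
  exists A y C, [/\ p = A ++ y :: C, ~~ r (last u A) y & path r y C].
Proof.
elim: p u => //= w p IH u; have [wp|/IH[A [y [C [-> bad good]]]]] := boolP (path r w p).
  by rewrite andbT => bad; exists [::], w, p.
by move=> _; exists (w :: A), y, C.
Qed.

(** Rightmost out-edges force both paths step by step, and [p] cannot stop first because it ends at
    the sink. *)
Lemma last_out_prefix u p q : path last_out u p -> path last_out u q -> last u p = t ->
  exists p', p = q ++ p'.
Proof.
elim: q u p => [|w q IH] u p; first by exists p.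
case: p => [_ /= /andP[/andP[uw _] _] ut|a p /= /andP[/andP[_ /eqP ->] pa]].
  by rewrite ut (negPf (sink_out G w)) in uw.
case/andP=> /andP[_ /eqP ->] qa pt.
by have [p' ->] := IH _ _ pa qa pt; exists p'.
Qed.

(** The last frontier edge that is not rightmost at its tail is chosen. All later frontier edges are
    rightmost, and so are the later edges of the left path of the face to its right; hence that path
    is a stretch of the frontier. *)
Lemma sweep_step F T D L pos : sweep_state F T D L pos -> ~~ path last_out s F ->
  exists F1 T1 D1 L1 pos1, sweep_state F1 T1 D1 L1 pos1 /\ #|D| < #|D1|.
Proof.
move=> st /last_bad_edge[A [y [C [FE bad goodC]]]].
have [vy _ _] : [/\ e (last s A) y, last s A \in T & y \in T].
  apply/(drawn_edge st)/(frontier_D st).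
  by rewrite FE walk_cat mem_cat mem_head orbT.
have yout : y \in outs (last s A) by rewrite (mem_outs G).
have [O1 [x [O2 outsE]]] : exists O1 x O2, outs (last s A) = O1 ++ y :: x :: O2.
  move: bad; rewrite /last_out vy; case/splitPr: yout => O1 [|x O2]; last by exists O1, x, O2.
  by rewrite cats1 last_rcons eqxx.
have [xs [z [x2 [ys [lpath rpath rin [I1 [I2 insE]]]]]]] := face_right G outsE.
have yt : last y C = t by have := frontier_end st; rewrite FE last_cat.
have [C' CE] := last_out_prefix goodC lpath yt.
rewrite FE CE -cat_cons in st.
apply: (sweep_face st lpath rpath rin).
  by have := uniq_outs G (last s A); rewrite outsE; apply: index_next.
by have := uniq_ins G z; rewrite insE; apply: index_next.
Qed.

(** The number of undrawn edges decreases until every frontier edge is rightmost at its tail. Then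
    drawn vertices have all their out-edges drawn, and every vertex is reachable from [s]. *)
Lemma sweep_complete : exists F T D L pos,
  [/\ sweep_state F T D L pos, forall u, u \in T & forall u w, ((u, w) \in D) = e u w].
Proof.
have [F [T [D [L [pos [st done]]]]]] :
    exists F T D L pos, sweep_state F T D L pos /\ path last_out s F.
  have [F0 [T0 [D0 [L0 [pos0 st0]]]]] := sweep_start.
  have [n] := ubnP (#|edges e| - #|D0|).
  elim: n F0 T0 D0 L0 pos0 st0 => // n IH F T D L pos st lt_n.
  have [done|more] := boolP (path last_out s F); first by exists F, T, D, L, pos.
  have [F1 [T1 [D1 [L1 [pos1 [st1 lt_D]]]]]] := sweep_step st more.
  have le_D1 : #|D1| <= #|edges e|.
    by apply/subset_leq_card/subsetP=> -[a b] /(drawn_edge st1)[ab _ _]; rewrite in_set.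
  by apply: IH st1 _; move: lt_n lt_D le_D1; lia.
have allD a b : a \in T -> e a b -> (a, b) \in D.
  move=> aT ab; have [aF|aF] := boolP (a \in s :: F); last exact: (drawn_all st).
  have [c ac] : exists c, (a, c) \in walk s F.
    apply: walk_from; move: aF; rewrite lastI mem_rcons inE => /predU1P[|//].
    by rewrite (frontier_end st) => at_; rewrite at_ (negPf (sink_out G b)) in ab.
  rewrite (drawn_outs st ac ab); move: done; rewrite path_walk.
  move=> /allP/(_ _ ac)/andP[_ /= /eqP->].
  by apply: index_le_last; [apply: (uniq_outs G) | rewrite (mem_outs G)].
have reachT p a : a \in T -> path e a p -> last a p \in T.
  elim: p a => //= b p IH a aT /andP[ab bp]; apply: IH bp.
  by have [] := drawn_edge st (allD _ _ aT ab).
have allT u : u \in T.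
  have /connectP[p sp ->] := source_reaches G u.
  by apply: reachT sp; apply: (frontier_T st); rewrite mem_head.
exists F, T, D, L, pos; split=> // u w.
by apply/idP/idP=> [/(drawn_edge st)[]//|]; apply: allD.
Qed.

Lemma book_order : exists (pos : V -> nat) (L : {set V * V}),
  [/\ injective pos, forall u w, e u w -> pos u < pos w,
      forall a b c d, e a b -> e c d -> ((a, b) \in L) = ((c, d) \in L) ->
        ~~ [&& pos a < pos c, pos c < pos b & pos b < pos d],
      forall v x y, e v x -> e v y -> index x (outs v) < index y (outs v) ->
        if (v, y) \in L then ((v, x) \in L) && (pos y < pos x)
        else ((v, x) \in L) || (pos x < pos y)
    & forall v x y, e x v -> e y v -> index x (ins v) < index y (ins v) ->
        if (y, v) \in L then ((x, v) \in L) && (pos x < pos y)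
        else ((x, v) \in L) || (pos y < pos x)].
Proof.
have [F [T [D [L [pos [st allT DE]]]]]] := sweep_complete.
exists pos, L; split.
- by move=> u w; apply: (pos_inj st).
- by move=> u w; rewrite -DE; apply: (pos_lt st).
- move=> a b c d; rewrite -!DE => abD cdD; have [abL|abL] := boolP ((a, b) \in L).
    by move/esym; apply: (left_cross st).
  by move/esym/negbT; apply: (right_cross st).
- by move=> v x y; rewrite -!DE; apply: (outs_sorted st).
- by move=> v x y; rewrite -!DE; apply: (ins_sorted st).
Qed.

End Ordered.

(** * Cyclic sequences *)

Section Cyclic.

Variable V : finType.
Implicit Types (p q : seq V) (P : pred V).

(** If [P] were stable under [next], it would spread from [x] around the whole cycle. *)
Lemma cyclic_switch p P x y : uniq p -> x \in p -> P x -> y \in p -> ~~ P y ->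
  exists2 a, a \in p & P a && ~~ P (next p a).
Proof.
move=> Up xp Px yp nPy; apply/exists_inP; apply: contraR nPy => /exists_inPn stable.
have xy : fconnect (next p) x y by rewrite (fconnect_cycle (cycle_next Up)).
rewrite -(iter_findex xy); elim: (findex _ _ _) => //= n Pn.
have np : iter n (next p) x \in p by elim: n {Pn} => //= n; rewrite mem_next.
by have := stable _ np; rewrite Pn /= negbK.
Qed.

Lemma prev_walk c p a b : uniq (c :: p) -> (a, b) \in walk c p -> prev (c :: p) b = a.
Proof.
move=> Up ab; have := cycle_prev Up; rewrite /= rcons_path => /andP[+ _].
by rewrite path_walk => /allP/(_ _ ab) /= /eqP ->.
Qed.

Lemma prev_head c p : uniq (c :: p) -> prev (c :: p) c = last c p.
Proof. by move=> Up; have := cycle_prev Up; rewrite /= rcons_path => /andP[_ /eqP ->]. Qed.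

Lemma prev_next_in p q a b : uniq (p ++ a :: b :: q) -> prev (p ++ a :: b :: q) b = a.
Proof.
case: p => [|c p] Up; apply: prev_walk => //; first by rewrite mem_head.
by rewrite walk_cat mem_cat !inE eqxx !orbT.
Qed.

Lemma cut_cycle p c : uniq p -> c \in p ->
  exists i q, rot i p = c :: q /\ last c q = prev p c.
Proof.
move=> Up cp; case: (rot_to cp) => i q pE; exists i, q; split=> //.
by rewrite -(prev_rot i Up) pE prev_head // -pE rot_uniq.
Qed.

Lemma sorted_implies P p : sorted (fun a b => P a ==> P b) p ->
  p = filter (predC P) p ++ filter P p.
Proof.
elim: p => //= a p IH ap; have [Pa|nPa] /= := boolP (P a); last first.
  by rewrite -IH //; apply: path_sorted ap.
have /allP pP : all (fun b => P a ==> P b) p.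
  by apply: order_path_min ap => b c d; case: (P b); case: (P c).
have {}pP : all P p by apply/allP=> b /pP; rewrite Pa.
rewrite (all_filterP pP); have -> // : filter (predC P) p = [::].
by apply/eqP; rewrite -(negbK (_ == _)) -has_filter -all_predC; apply: sub_all pP => b /= ->.
Qed.

End Cyclic.

(** * Faces of a plane st-graph *)

(** Turns equality in a count into uniqueness: of the turns of a face, or of a transit angle at a
    vertex. *)
Lemma imset_tight (aT rT : finType) (g : aT -> rT) (A : {set aT}) (B : {set rT}) :
  B \subset g @: A -> #|A| = #|B| -> {in A &, injective g}.
Proof.
move=> /subset_leq_card BgA AB; apply/imset_injP.
by rewrite eqn_leq leq_imset_card AB.
Qed.

Lemma mem_split (T : eqType) (p : seq T) u : u \in p -> exists p1 p2, p = p1 ++ u :: p2.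
Proof. by case/splitPr=> p1 p2; exists p1, p2. Qed.

Section PlaneGraph.

Variables (V : finType) (e : rel V) (s t : V) (M : embedding V).
Hypothesis plane : plane_st_graph e M s t.
Hypothesis neq_st : s != t.

Let fn := face_next M.
Let rot_ := rotation M.

Lemma plane_acyclic u v : e u v -> connect e v u = false.
Proof. by case: plane => -[acyc _ _] _ _ _ _ /acyc /negPf. Qed.

Lemma edge_asym u v : e u v -> e v u = false.
Proof. by move=> uv; apply: contraFF (plane_acyclic uv) => /connect1. Qed.

Lemma plane_source v : (forall u, ~~ e u v) <-> v = s.
Proof.
case: plane => -[_ src _] _ _ _ _; split=> [no|->].
  by apply/eqP; rewrite -src; apply/forallP.
by apply/forallP; have := src s; rewrite eqxx.
Qed.

Lemma plane_sink v : (forall w, ~~ e v w) <-> v = t.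
Proof.
case: plane => -[_ _ snk] _ _ _ _; split=> [no|->].
  by apply/eqP; rewrite -snk; apply/forallP.
by apply/forallP; have := snk t; rewrite eqxx.
Qed.

Lemma s_no_in u : ~~ e u s. Proof. by have [_ ->] := plane_source s. Qed.
Lemma t_no_out w : ~~ e t w. Proof. by have [_ ->] := plane_sink t. Qed.

Lemma uniq_rot v : uniq (rot_ v).
Proof. by case: plane => _ rs _ _ _; case: (rs v). Qed.

Lemma mem_rot_ v w : (w \in rot_ v) = e v w || e w v.
Proof. by case: plane => _ rs _ _ _; case: (rs v) => _ /(_ w). Qed.

(** A height function: by acyclicity it increases strictly along edges. *)
Definition ancestors v := #|[set u | connect e u v]|.

Lemma ancestors_lt u v : e u v -> ancestors u < ancestors v.
Proof.
move=> uv; apply/proper_card/properP; split.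
  by apply/subsetP=> w; rewrite !in_set => /connect_trans; apply; apply: connect1.
by exists v; rewrite in_set ?connect0 // plane_acyclic.
Qed.

Lemma ancestors_le v : ancestors v <= #|V|.
Proof. exact: max_card. Qed.

Lemma connect_source v : connect e s v.
Proof.
have [n] := ubnP (ancestors v); elim: n v => // n IH v lt_n.
have [->|vs] := eqVneq v s; first exact: connect0.
have [/existsP[u uv]|/existsPn no] := boolP [exists u, e u v].
  by apply: connect_trans (connect1 uv); apply/IH/(leq_trans (ancestors_lt uv)).
by case/eqP: vs; apply/plane_source.
Qed.

Lemma fnE u v : fn (u, v) = (v, prev (rot_ v) u). Proof. by []. Qed.

Lemma fn_inj : injective fn.
Proof.
move=> [u v] [u' v']; rewrite !fnE => -[<-].
by move/(can_inj (next_prev (uniq_rot v))) => ->.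
Qed.

Lemma fn_sym d d' : fconnect fn d d' = fconnect fn d' d.
Proof. exact: fconnect_sym fn_inj _ _. Qed.

Lemma face_of_eq d d' : (face_of M d == face_of M d') = fconnect fn d d'.
Proof.
apply/eqP/idP => [eq_f|dd'].
  by move/setP: eq_f => /(_ d'); rewrite !in_set connect0.
by apply/setP=> d2; rewrite !in_set; apply: same_connect fn_sym _ _ dd' _.
Qed.

Lemma mem_face_of d d' : (d' \in face_of M d) = fconnect fn d d'.
Proof. by rewrite in_set. Qed.

(** * Angles of faces and their number *)

Definition up d := e d.1 d.2.
Definition down d := e d.2 d.1.

Lemma down_not_up d : down d -> up d = false.
Proof. exact: edge_asym. Qed.

(** A degenerate dart would need an isolated vertex, which is both source and sink; [neq_st]
    excludes it. *)
Lemma dartsE d : (d \in darts M) = up d || down d.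
Proof.
case: d => u v; rewrite in_set /= mem_rot_ /up /down /=.
suff -> : nilp (rotation M u) = false by rewrite andbF orbF.
apply/negP=> /nilP u_iso; have no w : ~~ (e u w || e w u) by rewrite -mem_rot_ /rot_ u_iso.
have us : u = s by apply/plane_source=> w; have /norP[] := no w.
have ut : u = t by apply/plane_sink=> w; have /norP[] := no w.
by case/eqP: neq_st; rewrite -us.
Qed.

Lemma fn_dart d : up d || down d -> up (fn d) || down (fn d).
Proof.
case: d => u v; rewrite fnE /up /down /= orbC -mem_rot_ => uv.
by rewrite -mem_rot_ mem_prev.
Qed.

(** A dart stands for the angle at its head between it and the next dart of its face. [up_down]
    collects the local sinks of faces, [down_up] the local sources, and the other two the angles
    where a face passes a vertex, on its left or on its right. *)
Definition up_down := [set d | up d && down (fn d)].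
Definition down_up := [set d | down d && up (fn d)].
Definition up_up := [set d | up d && up (fn d)].
Definition down_down := [set d | down d && down (fn d)].

Lemma card_up : #|up_down| + #|up_up| = #|edges e|.
Proof.
rewrite -(cardsID [set d | down (fn d)] (edges e)).
congr addn; apply: eq_card => d; rewrite !in_set //.
rewrite andbC; apply: andb_id2r => ud.
have : up (fn d) || down (fn d) by apply: fn_dart; rewrite (ud : up d).
by have [/down_not_up->|_] := boolP (down (fn d)); rewrite ?orbF // => ->.
Qed.

Lemma card_down : #|down_up| + #|down_down| = #|edges e|.
Proof.
have -> : #|edges e| = #|[set d | down d]|.
  have swap_inj : injective (fun d : V * V => (d.2, d.1)) by move=> [u v] [u' v'] [-> ->].
  rewrite -(card_imset (mem (edges e)) swap_inj); apply: eq_card => -[u v].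
  apply/imsetP/idP => [[[u' v']]|vu]; first by rewrite !in_set /= => uv [-> ->].
  by exists (v, u); rewrite ?in_set // in vu *.
rewrite -(cardsID [set d | up (fn d)] [set d | down d]).
congr addn; apply: eq_card => d; rewrite !in_set //.
rewrite andbC; apply: andb_id2r => dd.
have : up (fn d) || down (fn d) by apply: fn_dart; rewrite dd orbT.
by have [/down_not_up->|_] := boolP (down (fn d)); rewrite ?orbF // => ->.
Qed.

(** Heights grow along an upward stretch of a face, so it has to turn. *)
Lemma up_run d : up d -> exists2 d', d' \in up_down & fconnect fn d d'.
Proof.
have [n] := ubnP (#|V| - ancestors d.2); elim: n d => // n IH d lt_n ud.
have [dd|] := boolP (down (fn d)); first by exists d; rewrite ?in_set ?ud ?connect0.
have : up (fn d) || down (fn d) by apply: fn_dart; rewrite ud.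
move=> + /negPf fd; rewrite fd orbF => uf; have [||d' d'X fd'] := IH (fn d) => //.
  have lt_h : ancestors d.2 < ancestors (fn d).2 := ancestors_lt uf.
  by have := ancestors_le (fn d).2; lia.
by exists d'; rewrite // (connect_trans (fconnect1 fn d) fd').
Qed.

Lemma down_run d : down d -> exists2 d', d' \in down_up & fconnect fn d d'.
Proof.
have [n] := ubnP (ancestors d.2); elim: n d => // n IH d lt_n dd.
have [ud|fd] := boolP (up (fn d)); first by exists d; rewrite ?in_set ?dd ?connect0.
have : up (fn d) || down (fn d) by apply: fn_dart; rewrite dd orbT.
rewrite (negPf fd) => df; have [||d' d'X fd'] := IH (fn d) => //.
  have lt_h : ancestors (fn d).2 < ancestors d.2 := ancestors_lt df.
  by apply: leq_trans lt_h _; rewrite -ltnS.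
by exists d'; rewrite // (connect_trans (fconnect1 fn d) fd').
Qed.

Lemma faces_up_down : faces M \subset face_of M @: up_down.
Proof.
apply/subsetP=> f /imsetP[d]; rewrite dartsE => dud ->.
have [d1 d1X dd1] : exists2 d1, d1 \in up_down & fconnect fn d d1.
  case/orP: dud => [/up_run//|/down_run[d2]]; rewrite in_set => /andP[_ /up_run[d1 d1X d2d1]].
  move=> dd2; exists d1 => //; apply: connect_trans dd2 _.
  exact: connect_trans (fconnect1 fn d2) d2d1.
by apply/imsetP; exists d1 => //; apply/eqP; rewrite face_of_eq.
Qed.

Lemma faces_down_up : faces M \subset face_of M @: down_up.
Proof.
apply/subsetP=> f /imsetP[d]; rewrite dartsE => dud ->.
have [d1 d1Y dd1] : exists2 d1, d1 \in down_up & fconnect fn d d1.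
  case/orP: dud => [/up_run[d2]|/down_run//]; rewrite in_set => /andP[_ /down_run[d1 d1Y d2d1]].
  move=> dd2; exists d1 => //; apply: connect_trans dd2 _.
  exact: connect_trans (fconnect1 fn d2) d2d1.
by apply/imsetP; exists d1 => //; apply/eqP; rewrite face_of_eq.
Qed.

Lemma inner_ends v : v \in ~: [set s; t] -> (exists u, e u v) /\ (exists w, e v w).
Proof.
rewrite in_setC in_set2 negb_or => /andP[vs vt]; split; apply/existsP.
  by apply: contraR vs => /existsPn no; apply/eqP/plane_source.
by apply: contraR vt => /existsPn no; apply/eqP/plane_sink.
Qed.

(** Somewhere around an inner vertex, an out-neighbour is followed counterclockwise by an
    in-neighbour; the face in this angle passes upwards. *)
Lemma inner_up_up : ~: [set s; t] \subset snd @: up_up.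
Proof.
apply/subsetP=> v /inner_ends[[u uv] [w vw]].
have [|||||a av /andP[va]] := @cyclic_switch _ (rot_ v) (fun a => e v a) w u.
- exact: uniq_rot.
- by rewrite mem_rot_ vw.
- exact: vw.
- by rewrite mem_rot_ uv orbT.
- by rewrite edge_asym.
set b := next _ _ => nvb; have : b \in rot_ v by rewrite mem_next.
rewrite mem_rot_ (negPf nvb) orFb => bv; apply/imsetP; exists (b, v) => //.
by rewrite in_set fnE /up /= prev_next ?uniq_rot // va bv.
Qed.

Lemma inner_down_down : ~: [set s; t] \subset snd @: down_down.
Proof.
apply/subsetP=> v /inner_ends[[u uv] [w vw]].
have [|||||a av /andP[va]] := @cyclic_switch _ (rot_ v) (fun a => e a v) u w.
- exact: uniq_rot.
- by rewrite mem_rot_ uv orbT.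
- exact: uv.
- by rewrite mem_rot_ vw.
- by rewrite edge_asym.
set b := next _ _ => nvb; have : b \in rot_ v by rewrite mem_next.
rewrite mem_rot_ (negPf nvb) orbF => bv; apply/imsetP; exists (b, v) => //.
by rewrite in_set fnE /down /= prev_next ?uniq_rot // va bv.
Qed.

(* Every face has a source and a sink angle, every inner vertex an angle of    *)
(* each transit type; Euler's formula makes these lower bounds tight.         *)
Lemma angle_counts : [/\ #|up_down| = #|faces M|, #|down_up| = #|faces M|
  & #|up_up| = #|~: [set s; t]|].
Proof.
case: plane => _ _; rewrite /euler_planar => euler _ _.
have cU := card_up; have cD := card_down.
have hX := leq_trans (subset_leq_card faces_up_down) (leq_imset_card _ _).
have hY := leq_trans (subset_leq_card faces_down_up) (leq_imset_card _ _).
have hU := leq_trans (subset_leq_card inner_up_up) (leq_imset_card _ _).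
have hD := leq_trans (subset_leq_card inner_down_down) (leq_imset_card _ _).
have cV : 2 + #|~: [set s; t]| = #|V| by rewrite -(cardsC [set s; t]) cards2 neq_st.
move: euler cU cD hX hY hU hD cV.
move: #|up_down| #|down_up| #|up_up| #|down_down| #|~: [set s; t]| #|faces M| #|edges e| #|V|.
by move=> *; split; lia.
Qed.

Lemma up_down_unique : {in up_down &, forall d d', fconnect fn d d' -> d = d'}.
Proof.
have [c _ _] := angle_counts; have inj := imset_tight faces_up_down c.
by move=> d d' dX d'X; rewrite -face_of_eq => /eqP; apply: inj.
Qed.

Lemma down_up_unique : {in down_up &, forall d d', fconnect fn d d' -> d = d'}.
Proof.
have [_ c _] := angle_counts; have inj := imset_tight faces_down_up c.
by move=> d d' dX d'X; rewrite -face_of_eq => /eqP; apply: inj.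
Qed.

Lemma up_up_unique : {in up_up &, injective snd}.
Proof. by have [_ _ c] := angle_counts; apply: imset_tight inner_up_up c. Qed.

Lemma fconnect_dart d d' : up d || down d -> fconnect fn d d' -> up d' || down d'.
Proof.
move=> ud dd'; rewrite -(iter_findex dd').
by elim: (findex _ _ _) => //= n; apply: fn_dart.
Qed.

Lemma outer_face_of d : d \in outer_face M -> up d || down d /\ outer_face M = face_of M d.
Proof.
case: plane => _ _ _ /imsetP[d0 d0D ->] _; rewrite mem_face_of dartsE in d0D * => d0d.
by split; [apply: fconnect_dart d0d | apply/eqP; rewrite face_of_eq].
Qed.

Lemma outer_s : exists2 w, e s w & (s, w) \in outer_face M.
Proof.
case: plane => _ _ _ _ /andP[/existsP[w sw] _]; exists w => //.
by case: (outer_face_of sw); rewrite /up /down /= (negPf (s_no_in w)) orbF.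
Qed.

Lemma outer_t : exists2 u, e u t & (t, u) \in outer_face M.
Proof.
case: plane => _ _ _ _ /andP[_ /existsP[u tu]]; exists u => //.
by case: (outer_face_of tu); rewrite /up /down /= (negPf (t_no_out u)).
Qed.

(** An inner vertex is cut at its unique [up_up] angle, that is, on its left side; [s] and [t] are
    cut inside the outer face, which supplies the side that a missing in- or out-edge cannot
    show. *)
Lemma cut_rotation v : exists io : seq V * seq V,
  [/\ exists k, rotation M v = rot k (io.1 ++ rev io.2),
      io.1 =i [pred u | e u v], io.2 =i [pred w | e v w],
      v = s -> (s, head s io.2) \in outer_face M
    & v = t -> (t, last t io.1) \in outer_face M].
Proof.
have Ur := uniq_rot v.
have cutP c : c \in rot_ v -> exists q, [/\ exists k, rotation M v = rot k (c :: q),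
    c :: q =i rot_ v, uniq (c :: q), last c q = prev (rot_ v) c
    & prev (rot_ v) =1 prev (c :: q)].
  move=> cv; have [i [q [qE qlast]]] := cut_cycle Ur cv; exists q.
  split=> //; rewrite -?qE ?rot_uniq //; last by move=> a; rewrite prev_rot.
    by exists (size (rot i (rot_ v)) - i); rewrite -[RHS]/(rotr i _) rotK.
  by move=> a; rewrite mem_rot.
have [vs|vs] := eqVneq v s.
  have [w sw w_out] := outer_s; have wv : w \in rot_ v by rewrite vs mem_rot_ sw.
  (* Cutting just after [w] makes it the last item, hence the head of the reversed list of
     out-neighbours. *)
  have [|q [qrot qmem _ qlast _]] := cutP (next (rot_ v) w); first by rewrite mem_next.
  rewrite prev_next // in qlast.
  exists ([::], rev (next (rot_ v) w :: q)); split=> /=; rewrite ?revK //.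
  - by move=> u; rewrite vs inE (negPf (s_no_in u)).
  - by move=> u; rewrite mem_rev qmem mem_rot_ inE vs (negPf (s_no_in u)) orbF.
  - by rewrite -nth0 nth_rev //= subn1 /= nth_last /= qlast.
  by rewrite vs => /eqP; rewrite (negPf neq_st).
have [vt|vt] := eqVneq v t.
  have [w wt w_out] := outer_t; have wv : w \in rot_ v by rewrite vt mem_rot_ wt orbT.
  have [|q [qrot qmem _ qlast _]] := cutP (next (rot_ v) w); first by rewrite mem_next.
  rewrite prev_next // in qlast.
  exists (next (rot_ v) w :: q, [::]); split=> //=; rewrite ?cats0 //.
  - by move=> u; rewrite qmem mem_rot_ inE vt (negPf (t_no_out u)).
  - by move=> u; rewrite vt inE (negPf (t_no_out u)).
  - by move/eqP; rewrite (negPf vs).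
  by rewrite qlast.
have vin : v \in ~: [set s; t] by rewrite in_setC in_set2 negb_or vs.
have /imsetP[[c v'] cX /= vE] := subsetP inner_up_up v vin; rewrite -{v'}vE in cX.
have [cv vc] : e c v /\ e v (prev (rot_ v) c).
  by move: cX; rewrite in_set fnE /up => /andP.
have [|q [qrot qmem Uq qlast qprev]] := cutP c; first by rewrite mem_rot_ cv orbT.
(* An in-neighbour right after an out-neighbour would give a second [up_up] angle at [v]. *)
have q_sorted : sorted (fun a b => e v a ==> e v b) (c :: q).
  rewrite /= path_walk; apply/allP=> -[a b] ab /=; apply/implyP=> va; apply/contraT=> vb.
  have bq := walk_head_in ab; have bv : e b v.
    by have := qmem b; rewrite in_cons bq orbT mem_rot_ (negPf vb) => /esym.
  have bX : (b, v) \in up_up by rewrite in_set fnE qprev (prev_walk Uq ab) /up /= bv.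
  have [bc] : (b, v) = (c, v) by apply: up_up_unique.
  by case/andP: Uq; rewrite -bc bq.
have qE := sorted_implies q_sorted; move: (c :: q) qrot qmem qE => p qrot qmem qE.
exists (filter (predC (fun b => e v b)) p, rev (filter (fun b => e v b) p)).
split=> /=; rewrite ?revK.
- by rewrite -qE.
- move=> u; rewrite mem_filter qmem mem_rot_ !inE; have [vu|//] := boolP (e v u).
  by rewrite edge_asym.
- by move=> u; rewrite mem_rev mem_filter qmem mem_rot_ !inE; case: (e v u).
- by move/eqP; rewrite (negPf vs).
by move/eqP; rewrite (negPf vt).
Qed.

(** * The two boundary paths of a face *)

Section LeftToRight.

Variables ins outs : V -> seq V.
Hypothesis rotationE : forall v, exists k, rotation M v = rot k (ins v ++ rev (outs v)).
Hypothesis insE : forall v, ins v =i [pred u | e u v].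
Hypothesis outsE : forall v, outs v =i [pred w | e v w].
Hypothesis outer_head : (s, head s (outs s)) \in outer_face M.
Hypothesis outer_last : (t, last t (ins t)) \in outer_face M.

Lemma uniq_ins_outs v : uniq (ins v ++ rev (outs v)).
Proof. by have := uniq_rot v; rewrite /rot_; have [k ->] := rotationE v; rewrite rot_uniq. Qed.

Lemma prev_rotE v : prev (rot_ v) =1 prev (ins v ++ rev (outs v)).
Proof.
by move=> a; rewrite /rot_; have [k ->] := rotationE v; rewrite prev_rot ?uniq_ins_outs.
Qed.

Lemma prev_outs v O1 y x O2 : outs v = O1 ++ y :: x :: O2 -> prev (rot_ v) y = x.
Proof.
move=> vE; rewrite prev_rotE; have := uniq_ins_outs v; rewrite vE.
have -> : rev (O1 ++ y :: x :: O2) = rev O2 ++ x :: y :: rev O1.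
  by rewrite rev_cat !rev_cons -!cats1 -!catA.
by rewrite catA => /prev_next_in.
Qed.

Lemma prev_ins v I1 l r I2 : ins v = I1 ++ l :: r :: I2 -> prev (rot_ v) r = l.
Proof.
by move=> vE; rewrite prev_rotE; have := uniq_ins_outs v; rewrite vE -catA => /prev_next_in.
Qed.

Lemma prev_first_in v u q : ins v = u :: q ->
  prev (rot_ v) u = last (last u q) (rev (outs v)).
Proof.
move=> vE; rewrite prev_rotE; have := uniq_ins_outs v; rewrite vE cat_cons.
by move/prev_head=> ->; rewrite last_cat.
Qed.

(** Before any in-neighbour but the first comes another in-neighbour, so an upward passage can only
    occur at the cut. *)
Lemma up_up_first u v : (u, v) \in up_up ->
  u = head v (ins v) /\ prev (rot_ v) u = head v (outs v).
Proof.
rewrite in_set fnE /up /= => /andP[uv v_prev].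
have [I1 [I2 vE]] : exists I1 I2, ins v = I1 ++ u :: I2 by apply: mem_split; rewrite insE.
case/lastP: I1 vE => [|I1 l] vE; last first.
  rewrite cat_rcons in vE; rewrite (prev_ins vE) in v_prev.
  have := insE v l; rewrite inE vE mem_cat mem_head orbT => /esym lv.
  by rewrite edge_asym in v_prev.
split; first by rewrite vE.
rewrite (prev_first_in vE); have := outsE v (prev (rot_ v) u); rewrite inE v_prev.
by case: (outs v) => // w O _; rewrite rev_cons last_rcons.
Qed.

Lemma down_down_last u v : (u, v) \in down_down ->
  u = last v (outs v) /\ prev (rot_ v) u = last v (ins v).
Proof.
rewrite in_set fnE /down /= => /andP[vu prev_v].
have [O1 [O2 vE]] : exists O1 O2, outs v = O1 ++ u :: O2 by apply: mem_split; rewrite outsE.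
case: O2 vE => [|x O2] vE; last first.
  rewrite (prev_outs vE) in prev_v.
  have := outsE v x; rewrite inE vE mem_cat !in_cons eqxx !orbT => /esym vx.
  by rewrite edge_asym in prev_v.
split; first by rewrite vE last_cat.
have := insE v (prev (rot_ v) u); rewrite inE prev_v prev_rotE.
have := uniq_ins_outs v; rewrite vE rev_cat /=.
case/lastP: (ins v) => // I l; rewrite cat_rcons last_rcons => U _.
exact: prev_next_in U.
Qed.

(** The angle at the cut lies between two in-edges only when there are no out-edges, that is at [t],
    where the cut is in the outer face. *)
Lemma up_down_ins u v (l := prev (rot_ v) u) : (u, v) \in up_down ->
  (exists I1 I2, ins v = I1 ++ l :: u :: I2)
  \/ [/\ v = t, (t, l) \in outer_face M & u = head v (ins v)].
Proof.
rewrite in_set fnE /up /down /= => /andP[uv prev_v].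
have [I1 [I2 vE]] : exists I1 I2, ins v = I1 ++ u :: I2 by apply: mem_split; rewrite insE.
case/lastP: I1 vE => [|I1 l'] vE; last first.
  by rewrite cat_rcons in vE; left; exists I1, I2; rewrite /l (prev_ins vE).
right; have lE := prev_first_in vE; rewrite -/l in lE prev_v.
case outs_v: (outs v) => [|w O].
  have vt : v = t by apply/plane_sink=> w; have := outsE v w; rewrite outs_v inE => <-.
  move: outer_last; rewrite -vt vE /= => outer_l.
  by split=> //; rewrite lE outs_v.
have : e v l.
  rewrite lE outs_v rev_cons last_rcons.
  by have := outsE v w; rewrite outs_v mem_head inE => <-.
by move=> vl; rewrite edge_asym in prev_v.
Qed.

(** Keeps the face on the left up to its sink. The [first_in] claim omits the final edge, which need
    not be leftmost at that sink. *)
Lemma climb a b : e a b -> exists p, [/\ path (first_out e outs) b p,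
  path (first_in e ins) a (belast b p), fpath fn (a, b) (walk b p)
  & last (a, b) (walk b p) \in up_down].
Proof.
have [n] := ubnP (#|V| - ancestors b); elim: n a b => // n IH a b lt_n ab.
have [dd|nd] := boolP (down (fn (a, b))).
  by exists [::]; split; rewrite //= in_set dd andbT.
have ub : up (fn (a, b)).
  have : up (fn (a, b)) || down (fn (a, b)) by apply: fn_dart; rewrite /up /= ab.
  by rewrite (negPf nd) orbF.
have [aE cE] : a = head b (ins b) /\ prev (rot_ b) a = head b (outs b).
  by apply: up_up_first; rewrite in_set ub andbT.
move: ub; rewrite fnE; move: (prev (rot_ b) a) cE (fnE a b) => c cE fab bc.
have [|//|p [p_out p_in p_fn p_last]] := IH b c.
  by have := ancestors_lt (bc : e b c); have := ancestors_le c; lia.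
exists (c :: p); split=> /=.
- by rewrite p_out andbT /first_out (bc : e b c) -cE eqxx.
- by rewrite p_in andbT /first_in ab -aE eqxx.
- by rewrite p_fn fab eqxx.
- exact: p_last.
Qed.

(** The counterpart of [climb], down the left path of a face to its source; the [last_out] claim
    omits the edge leaving that source. *)
Lemma descend a b : e b a -> exists p,
  [/\ path (fun v u => e u v) b p,
      path (fun v u => last_out e outs u v) a (belast b p),
      fpath fn (a, b) (walk b p)
    & last (a, b) (walk b p) \in down_up].
Proof.
have [n] := ubnP (ancestors b); elim: n a b => // n IH a b lt_n ba.
have [ub|nu] := boolP (up (fn (a, b))).
  by exists [::]; split; rewrite //= in_set ub andbT.
have db : down (fn (a, b)).
  have : up (fn (a, b)) || down (fn (a, b)) by apply: fn_dart; rewrite /down /= ba orbT.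
  by rewrite (negPf nu).
have [aE cE] : a = last b (outs b) /\ prev (rot_ b) a = last b (ins b).
  by apply: down_down_last; rewrite in_set db andbT.
move: db; rewrite fnE; move: (prev (rot_ b) a) cE (fnE a b) => c cE fab cb.
have [|//|p [p_e p_out p_fn p_last]] := IH b c.
  by rewrite -ltnS; apply: leq_trans (ancestors_lt (cb : e c b)) _.
exists (c :: p); split=> /=.
- by rewrite p_e andbT; apply: cb.
- by rewrite p_out andbT /last_out ba -aE eqxx.
- by rewrite p_fn fab eqxx.
- exact: p_last.
Qed.

Lemma uniq_outs_list v : uniq (outs v).
Proof. by have := uniq_ins_outs v; rewrite cat_uniq rev_uniq => /and3P[]. Qed.

Lemma uniq_ins_list v : uniq (ins v).
Proof. by have := uniq_ins_outs v; rewrite cat_uniq => /and3P[]. Qed.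

Lemma fconnect_path d l d' : fpath fn d l -> d' \in d :: l -> fconnect fn d d'.
Proof. by move=> dl /(path_connect dl). Qed.

Lemma outer_down_up : exists2 y, (y, s) \in down_up & fn (y, s) = (s, head s (outs s)).
Proof.
have [] := outer_face_of outer_head; set w := head s (outs s).
rewrite /up /down /= (negPf (s_no_in w)) orbF => sw _.
have fnw : fn (next (rot_ s) w, s) = (s, w) by rewrite fnE prev_next ?uniq_rot.
exists (next (rot_ s) w) => //; rewrite in_set fnw /up /down /= sw andbT.
have : next (rot_ s) w \in rot_ s by rewrite mem_next mem_rot_ sw.
by rewrite mem_rot_ (negPf (s_no_in _)) orbF.
Qed.

Lemma outer_up_down : exists2 u, (u, t) \in up_down & fn (u, t) = (t, last t (ins t)).
Proof.
have [] := outer_face_of outer_last; set w := last t (ins t).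
rewrite /up /down /= (negPf (t_no_out w)) /= => wt _.
have fnw : fn (next (rot_ t) w, t) = (t, w) by rewrite fnE prev_next ?uniq_rot.
exists (next (rot_ t) w) => //; rewrite in_set fnw /up /down /= wt andbT.
have : next (rot_ t) w \in rot_ t by rewrite mem_next mem_rot_ wt orbT.
by rewrite mem_rot_ (negPf (t_no_out _)).
Qed.

Lemma walk_last a b (p : seq V) :
  last (a, b) (walk b p) = (last a (belast b p), last b p).
Proof. by elim: p a b => //= c p IH a b; rewrite IH. Qed.

(** The outer face has a single source angle, at [s] and before its leftmost out-edge; here [x] has
    [y] on its left. *)
Lemma inner_face_internal v O1 y x O2 : outs v = O1 ++ y :: x :: O2 ->
  face_of M (v, x) \in internal_faces M.
Proof.
move=> vE; have [vy vx] : e v y /\ e v x.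
  by have := (outsE v y, outsE v x); rewrite !inE vE !mem_cat !inE !eqxx !orbT => -[<- <-].
rewrite in_setD1 imset_f ?dartsE /up /down ?vx // andbT; apply/eqP=> outerE.
have [y1 y1Y fny1] := outer_down_up; have fny : fn (y, v) = (v, x) by rewrite fnE (prev_outs vE).
have yY : (y, v) \in down_up by rewrite in_set fny /up /down /= vy vx.
have : fconnect fn (y, v) (y1, s).
  apply: connect_trans (fconnect1 fn _) _; rewrite fny fn_sym.
  apply: connect_trans (fconnect1 fn _) _; rewrite fny1 fn_sym.
  by rewrite -mem_face_of outerE outer_head.
move/(down_up_unique yY y1Y) => yE; move: fny1; rewrite -yE fny => -[vs xE].
have := uniq_outs_list v; move: xE; rewrite -vs vE; case: O1 {vE} => [|w O1] /= ->.
  by rewrite mem_head.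
by rewrite mem_cat !in_cons eqxx !orbT.
Qed.

(** Climbing the outer face from [s] stops at its only sink angle, which is at [t]; that angle is at
    the cut of [t], so the final edge is leftmost there too. *)
Lemma left_border_path : exists p, [/\ path (first_out e outs) s p,
  path (first_in e ins) s p & last s p = t].
Proof.
have [] := outer_face_of outer_head; set w := head s (outs s).
rewrite /up /down /= (negPf (s_no_in w)) orbF => sw outerE.
have [p [p_out p_in p_fn]] := climb sw; rewrite walk_last.
set u := last s (belast w p); set z := last w p => uz.
have [u1 u1X fnu1] := outer_up_down.
have ends : (u, z) = (u1, t).
  apply: up_down_unique => //; rewrite fn_sym.
  apply: connect_trans (fconnect1 fn _) _; rewrite fnu1.
  apply: (@connect_trans _ _ (s, w)).
    by rewrite fn_sym -mem_face_of -outerE outer_last.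
  by apply: fconnect_path p_fn _; rewrite /u /z -walk_last mem_last.
have [uu1 zt] : u = u1 /\ z = t by case: ends.
exists (w :: p); split=> //.
  by rewrite /= p_out andbT /first_out sw eqxx.
have wp : path (first_in e ins) s (belast w p) && first_in e ins u z.
  rewrite p_in /= /first_in; move: uz; rewrite in_set => /andP[/= uz _].
  rewrite [e u z]uz /=; apply/eqP; rewrite zt; move: uz; rewrite zt => ut.
  have u1E : prev (rot_ t) u1 = last t (ins t) by move: fnu1; rewrite fnE => -[].
  have : u \in ins t by rewrite insE.
  case insE_t: (ins t) => [|a I]; first by [].
  have aE : prev (rot_ t) a = last t (ins t).
    rewrite (prev_first_in insE_t) insE_t /=.
    case outs_t: (outs t) => [|b O] //.
    by have := outsE t b; rewrite outs_t mem_head inE (negPf (t_no_out b)).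
  by move=> _; apply: (can_inj (next_prev (uniq_rot t))); rewrite uu1 u1E.
by rewrite lastI rcons_path.
Qed.

Hypothesis long_faces : forall f : {set V * V}, f \in internal_faces M ->
  2 <= #|left_path e M f| /\ 3 <= #|right_path e M f|.

(** Climbing from [(v, x)], turning at the sink and descending leads to a source angle, which by
    uniqueness is the one at [v]. This closes the orbit, so the face has no darts besides those of
    the two paths, and the cardinality hypotheses bound their lengths. *)
Lemma face_right_paths v O1 y x O2 : outs v = O1 ++ y :: x :: O2 ->
  exists xs z x2 ys, [/\ path (last_out e outs) y (rcons xs z),
    path (first_out e outs) x (rcons (x2 :: ys) z),
    path (first_in e ins) v [:: x, x2 & ys] &
    exists I1 I2, ins z = I1 ++ last y xs :: last x2 ys :: I2].
Proof.
move=> vE; have f_internal := inner_face_internal vE.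
have [vy vx] : e v y /\ e v x.
  by have := (outsE v y, outsE v x); rewrite !inE vE !mem_cat !inE !eqxx !orbT => -[<- <-].
have fny : fn (y, v) = (v, x) by rewrite fnE (prev_outs vE).
have yY : (y, v) \in down_up by rewrite in_set fny /up /down /= vy vx.
have [p [p_out p_in p_fn]] := climb vx; rewrite walk_last.
set u := last v (belast x p); set z := last x p => uz.
have bz : e (prev (rot_ z) u) z by move: uz; rewrite in_set => /andP[_].
move: (fnE u z) bz; set b := prev (rot_ z) u => fnuz bz.
have [q [q_e q_out q_fn]] := descend bz; rewrite walk_last => qY.
have cyc_path : fpath fn (v, x) (walk x p ++ walk z (b :: q)).
  by rewrite cat_path p_fn walk_last /= -/z fnuz eqxx.
have last_cyc : last (v, x) (walk x p ++ walk z (b :: q)) = (y, v).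
  rewrite last_cat walk_last /= walk_last; apply: down_up_unique => //.
  rewrite fn_sym; apply: connect_trans (fconnect1 fn _) _; rewrite fny.
  apply: fconnect_path cyc_path _.
  by have := mem_last (v, x) (walk x p ++ walk z (b :: q)); rewrite last_cat walk_last /= walk_last.
have cyc : fcycle fn (walk v (x :: p) ++ walk z (b :: q)).
  by rewrite /= rcons_path cyc_path last_cyc /= fny.
have mem_f d : d \in face_of M (v, x) -> d \in walk v (x :: p) ++ walk z (b :: q).
  by rewrite mem_face_of (fconnect_cycle cyc) // mem_head.
have p_up d : d \in walk v (x :: p) -> up d.
  move: (p_out); rewrite inE path_walk => /allP p_up /predU1P[->//|/p_up/andP[]] //.
have q_down d : d \in walk z (b :: q) -> down d.
  move: (q_e); rewrite inE path_walk => /allP q_down /predU1P[->//|/q_down] //.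
have [left2 right3] := long_faces f_internal.
have size_q : 0 < size q.
  rewrite -ltnS; apply: leq_trans left2 _.
  rewrite -[_.+1]/(size (b :: q)) -(size_pairmap pair z) -(size_map (fun d => (d.2, d.1))).
  apply: leq_trans (card_size _); apply: subset_leq_card; apply/subsetP=> -[c d].
  rewrite in_set /right_face => /andP[]; rewrite in_set => cd /eqP fcd.
  apply/mapP; exists (d, c) => //.
  have : (d, c) \in face_of M (v, x) by rewrite -fcd mem_face_of connect0.
  move/mem_f; rewrite mem_cat => /orP[/p_up|//].
  by rewrite /up /= edge_asym.
have size_p : 1 < size p.
  rewrite -ltnS; apply: leq_trans right3 _.
  rewrite -[_.+1]/(size (x :: p)) -(size_pairmap pair v).
  apply: leq_trans (card_size _); apply: subset_leq_card; apply/subsetP=> -[c d].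
  rewrite in_set /left_face => /andP[]; rewrite in_set => cd /eqP fcd.
  have : (c, d) \in face_of M (v, x) by rewrite -fcd mem_face_of connect0.
  move/mem_f; rewrite mem_cat => /orP[//|/q_down].
  by rewrite /down /= edge_asym.
have z_split : exists I1 I2, ins z = I1 ++ b :: u :: I2.
  have [//|[zt tb _]] := up_down_ins uz.
  move: f_internal; rewrite in_setD1 => /andP[/eqP[]].
  have [_ ->] := outer_face_of tb; apply/eqP; rewrite face_of_eq.
  have -> : (t, prev (rot_ z) u) = (z, b) by rewrite -[t in (t, _)]zt.
  have zb : (z, b) \in walk z (b :: q) by exact: mem_head.
  by apply: fconnect_path cyc_path _; rewrite in_cons mem_cat zb !orbT.
have [x2 [ys pE]] : exists x2 ys, p = rcons (x2 :: ys) z.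
  rewrite /z; case/lastP: p size_p {p_out p_in p_fn uz bz fnuz cyc_path last_cyc cyc mem_f p_up
    z_split q_e q_out q_fn qY q_down u z b} => // p z.
  by rewrite size_rcons last_rcons; case: p => // x2 ys _; exists x2, ys.
have uE : u = last x2 ys by rewrite /u pE belast_rcons.
move: last_cyc; rewrite last_cat walk_last /= walk_last => -[yE lastq].
have [q' qE] : exists q', q = rcons q' v.
  by case/lastP: (q) size_q lastq => // q' a _; rewrite last_rcons => ->; exists q'.
rewrite qE belast_rcons /= in yE q_out.
exists (rev (belast b q')), z, x2, ys; split.
- have := rev_path (last_out e outs) z (b :: q'); rewrite /= yE rev_cons => ->.
  exact: q_out.
- by move: p_out; rewrite {1}pE.
- by move: p_in; rewrite {1}pE belast_rcons.
suff <- : b = last y (rev (belast b q')) by rewrite -uE.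
by case: (q') yE => //= c r _; rewrite rev_cons last_rcons.
Qed.

Lemma ordered_ins_outs : ordered_st_graph e s t ins outs.
Proof.
split.
- by move=> v u; rewrite insE inE.
- by move=> v w; rewrite outsE inE.
- exact: uniq_ins_list.
- exact: uniq_outs_list.
- by exists ancestors; apply: ancestors_lt.
- exact: connect_source.
- exact: s_no_in.
- exact: t_no_out.
- exact: left_border_path.
- exact: face_right_paths.
Qed.

End LeftToRight.

Lemma plane_ordered :
  (forall f : {set V * V}, f \in internal_faces M ->
     2 <= #|left_path e M f| /\ 3 <= #|right_path e M f|) ->
  exists ins outs : V -> seq V, [/\ ordered_st_graph e s t ins outs,
    forall v, exists k, rotation M v = rot k (ins v ++ rev (outs v))
  & outer_face M = face_of M (s, head s (outs s))].
Proof.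
move=> long_faces; have [io ioP] := fin_all_exists cut_rotation.
have [_ _ _ /(_ erefl) outer_s _] := ioP s; have [_ _ _ _ /(_ erefl) outer_t] := ioP t.
exists (fun v => (io v).1), (fun v => (io v).2); split.
- by apply: ordered_ins_outs => // v; case: (ioP v).
- by move=> v; case: (ioP v).
by case: (outer_face_of outer_s).
Qed.

End PlaneGraph.

(** * The canonical drawing *)

Lemma index_pairwise (T : eqType) (r : rel T) (p : seq T) : uniq p ->
  {in p &, forall x y, index x p < index y p -> r x y} -> pairwise r p.
Proof.
case: p => // x0 p Up rp; apply/(pairwiseP x0) => i j; rewrite !inE => ip jp ij.
by apply: rp; rewrite ?mem_nth ?index_uniq.
Qed.

Lemma rot_rot_ex (T : Type) (p : seq T) i j : exists k, rot i (rot j p) = rot k p.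
Proof.
have [ip|/ltnW ip] := leqP i (size p); last by exists j; rewrite rot_oversize ?size_rot.
have [jp|/ltnW jp] := leqP j (size p); last by exists i; rewrite (rot_oversize jp).
by rewrite rot_add_mod //; eexists.
Qed.

Lemma rot_sym_ex (T : Type) (p q : seq T) : (exists k, p = rot k q) -> exists k, q = rot k p.
Proof. by case=> k ->; exists (size (rot k q) - k); rewrite -[RHS]/(rotr k _) rotK. Qed.

Section Drawing.

Variables (V : finType) (e : rel V) (pi : V -> 'I_#|V|) (sigma : V * V -> page) (v : V).
Hypothesis pi_inj : injective pi.
Local Notation ccw := (ccw_le e pi sigma v).
Local Notation height w := (arc_height pi v w).

Lemma arc_height_inj : injective (arc_height pi v).
Proof. by move=> w w' /invr_inj /addIr /eqP; rewrite eqr_nat => /eqP /val_inj /pi_inj. Qed.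

Lemma ccw_total : total ccw.
Proof.
by move=> w w'; rewrite /ccw_le; case: arc_page; case: arc_page => //; apply: le_total.
Qed.

Lemma ccw_trans : transitive ccw.
Proof.
move=> b a c; rewrite /ccw_le.
case: (arc_page e sigma v a); case: (arc_page e sigma v b); case: (arc_page e sigma v c) => //.
  by move=> ba cb; apply: le_trans cb ba.
exact: le_trans.
Qed.

Lemma ccw_anti : antisymmetric ccw.
Proof.
move=> a b; rewrite /ccw_le; case: (arc_page e sigma v a); case: (arc_page e sigma v b) => //;
  by move/le_anti/arc_height_inj.
Qed.

Lemma height_below a b : pi a < pi b -> pi b < pi v -> (height b <= height a)%R.
Proof.
move=> ab bv; rewrite /arc_height lef_nV2 ?negrE ?subr_lt0 ?ltr_nat //; last exact: ltn_trans ab bv.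
by rewrite lerD2r ler_nat ltnW.
Qed.

Lemma height_above a b : pi v < pi a -> pi a < pi b -> (height b <= height a)%R.
Proof.
move=> va ab; rewrite /arc_height lef_pV2 ?posrE ?subr_gt0 ?ltr_nat //; last exact: ltn_trans va ab.
by rewrite lerD2r ler_nat ltnW.
Qed.

Lemma height_across a b : pi a < pi v -> pi v < pi b -> (height a <= height b)%R.
Proof.
move=> av vb; apply: (@le_trans _ _ 0%R); rewrite /arc_height.
  by rewrite invr_le0 subr_le0 ler_nat ltnW.
by rewrite invr_ge0 subr_ge0 ler_nat ltnW.
Qed.

End Drawing.

(** * The drawing of the constructed book has the given embedding *)

Section CanonicalEmbedding.

Variables (V : finType) (e : rel V) (s t : V) (M : embedding V) (ins outs : V -> seq V).
Hypothesis G : ordered_st_graph e s t ins outs.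
Hypothesis rotationE : forall v, exists k, rotation M v = rot k (ins v ++ rev (outs v)).
Hypothesis outerE : outer_face M = face_of M (s, head s (outs s)).

Variables (pos : V -> nat) (L : {set V * V}).
Hypothesis pos_injective : injective pos.
Hypothesis edge_pos : forall u w, e u w -> pos u < pos w.
Hypothesis no_cross : forall a b c d, e a b -> e c d ->
  ((a, b) \in L) = ((c, d) \in L) ->
  ~~ [&& pos a < pos c, pos c < pos b & pos b < pos d].
Hypothesis outs_order : forall v x y, e v x -> e v y ->
  index x (outs v) < index y (outs v) ->
  if (v, y) \in L then ((v, x) \in L) && (pos y < pos x)
  else ((v, x) \in L) || (pos x < pos y).
Hypothesis ins_order : forall v x y, e x v -> e y v ->
  index x (ins v) < index y (ins v) ->
  if (y, v) \in L then ((x, v) \in L) && (pos x < pos y)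
  else ((x, v) \in L) || (pos y < pos x).

Lemma rank_subproof v : #|[set u | pos u < pos v]| < #|V|.
Proof.
rewrite -cardsT; apply/proper_card/properP; split; first exact: subsetT.
by exists v; rewrite ?in_setT // in_set ltnn.
Qed.

(** Closes the gaps between the values of [pos]. *)
Definition rank v : 'I_#|V| := Ordinal (rank_subproof v).
Definition book_page (d : V * V) := if d \in L then LeftPage else RightPage.

Lemma rank_lt u v : (rank u < rank v) = (pos u < pos v).
Proof.
have mono a b : pos a < pos b -> rank a < rank b.
  move=> ab; apply/proper_card/properP; split.
    by apply/subsetP=> c; rewrite !in_set => /ltn_trans; apply.
  by exists a; rewrite in_set ?ltnn.
apply/idP/idP=> [uv|]; last exact: mono.
case: (ltngtP (pos u) (pos v)) => // [/mono vu|/pos_injective eq_uv].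
  by have := ltn_trans uv vu; rewrite ltnn.
by rewrite eq_uv ltnn in uv.
Qed.

Lemma rank_inj : injective rank.
Proof.
move=> u v uv; have := rank_lt u v; have := rank_lt v u.
by rewrite uv ltnn; case: ltngtP => // /pos_injective.
Qed.

Lemma e_asym u v : e u v -> e v u = false.
Proof. by move=> /edge_pos uv; apply/negP=> /edge_pos /(ltn_trans uv); rewrite ltnn. Qed.

Lemma two_UBE_rank : two_UBE e rank book_page.
Proof.
split.
- by apply: inj_card_bij rank_inj _; rewrite card_ord.
- by move=> u v /edge_pos; rewrite rank_lt.
move=> a b c d ab cd same; rewrite !rank_lt => -[ac cb bd].
have /negP[] : ~~ [&& pos a < pos c, pos c < pos b & pos b < pos d]; last by rewrite ac cb bd.
apply: no_cross => //; move: same; rewrite /book_page.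
by case: ((a, b) \in L); case: ((c, d) \in L).
Qed.

Let insL v := filter (predC (fun u => (u, v) \notin L)) (ins v).
Let insR v := filter (fun u => (u, v) \notin L) (ins v).

(** By [ins_order], left-page in-edges precede right-page ones. *)
Lemma ins_pages v : ins v = insL v ++ insR v.
Proof.
apply: sorted_implies; apply: pairwise_sorted; apply: index_pairwise (uniq_ins G v) _.
move=> x y; rewrite !(mem_ins G) => xv yv /(ins_order xv yv).
by case: ifP => [yL /andP[-> _]|_ _]; rewrite ?implybT.
Qed.

Local Notation ccw := (ccw_le e rank book_page).

Lemma arc_page_out v w : e v w -> arc_page e book_page v w = book_page (v, w).
Proof. by rewrite /arc_page => ->. Qed.

Lemma arc_page_in v u : e u v -> arc_page e book_page v u = book_page (u, v).
Proof. by rewrite /arc_page => uv; rewrite e_asym. Qed.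

Lemma pairwise_outs v : pairwise (ccw v) (rev (outs v)).
Proof.
rewrite -(sorted_pairwise (@ccw_trans _ _ _ _ v)) rev_sorted.
apply: pairwise_sorted; apply: index_pairwise (uniq_outs G v) _.
move=> x y; rewrite !(mem_outs G) => vx vy /(outs_order vx vy).
rewrite /ccw_le !arc_page_out // /book_page.
have [yL /andP[-> yx]|yR] := ifP; first by apply: height_above; rewrite rank_lt // edge_pos.
by case: ifP => //= _ xy; apply: height_above; rewrite rank_lt // edge_pos.
Qed.

Let in_rel v x y := if (y, v) \in L then ((x, v) \in L) && (pos x < pos y)
  else ((x, v) \in L) || (pos y < pos x).

Lemma pairwise_ins v : pairwise (in_rel v) (ins v).
Proof.
apply: index_pairwise (uniq_ins G v) _ => x y; rewrite !(mem_ins G) => xv yv.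
exact: ins_order.
Qed.

Lemma pairwise_insL v : pairwise (ccw v) (insL v).
Proof.
have := pairwise_filter (predC (fun u => (u, v) \notin L)) (pairwise_ins v).
apply: (@sub_in_pairwise _ [pred u | e u v && ((u, v) \in L)]).
  move=> x y /andP[xv xL] /andP[yv yL]; rewrite /in_rel yL xL /= => xy.
  rewrite /ccw_le !arc_page_in // /book_page xL yL.
  by apply: height_below; rewrite rank_lt // edge_pos.
by apply/allP=> u; rewrite mem_filter (mem_ins G) /= negbK andbC.
Qed.

Lemma pairwise_insR v : pairwise (ccw v) (insR v).
Proof.
have := pairwise_filter (fun u => (u, v) \notin L) (pairwise_ins v).
apply: (@sub_in_pairwise _ [pred u | e u v && ((u, v) \notin L)]).
  move=> x y /andP[xv /negPf xL] /andP[yv /negPf yL]; rewrite /in_rel yL xL /= => yx.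
  rewrite /ccw_le !arc_page_in // /book_page xL yL.
  by apply: height_below; rewrite rank_lt // edge_pos.
by apply/allP=> u; rewrite mem_filter (mem_ins G) /= andbC.
Qed.

(** Counterclockwise from below come the right in-arcs, the out-arcs from right to left, and the
    left in-arcs. As [ccw_le] is total, transitive and antisymmetric, an ordered list of the right
    members is the sorted one. *)
Lemma canonical_rotationE v :
  canonical_rotation e rank book_page v = insR v ++ rev (outs v) ++ insL v.
Proof.
set c := RHS; have c_pairwise : pairwise (ccw v) c.
  have insP u : u \in insR v -> e u v /\ book_page (u, v) = RightPage.
    by rewrite mem_filter (mem_ins G) /book_page => /andP[/negPf -> ->].
  have insLP u : u \in insL v -> e u v /\ book_page (u, v) = LeftPage.
    by rewrite mem_filter (mem_ins G) /book_page /= negbK => /andP[-> ->].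
  have outsP w : w \in rev (outs v) -> e v w by rewrite mem_rev (mem_outs G).
  rewrite !pairwise_cat pairwise_insR pairwise_outs pairwise_insL /= !andbT.
  apply/andP; split; apply/allrelP=> a b.
    move=> /insP[av aR]; rewrite mem_cat => /orP[/outsP vb|/insLP[bv bL]].
      rewrite /ccw_le (arc_page_in av) aR (arc_page_out vb) /book_page; case: ifP => // _.
      by apply: height_across; rewrite rank_lt edge_pos.
    by rewrite /ccw_le (arc_page_in av) aR (arc_page_in bv) bL.
  move=> /outsP va /insLP[bv bL]; rewrite /ccw_le (arc_page_in bv) bL (arc_page_out va).
  rewrite /book_page; case: ifP => // _.
  by apply: height_across; rewrite rank_lt edge_pos.
have ccwP := perm_sortP (@ccw_total _ e rank book_page v) (@ccw_trans _ e rank book_page v)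
  (@ccw_anti _ e rank book_page v rank_inj).
rewrite /canonical_rotation -(pairwise_sort c_pairwise); apply/ccwP.
apply: uniq_perm; first exact: enum_uniq.
  rewrite /c catA -rot_size_cat rot_uniq catA -ins_pages.
  rewrite cat_uniq (uniq_ins G) rev_uniq (uniq_outs G) andbT; apply/hasPn=> w.
  by rewrite mem_rev (mem_outs G) /= (mem_ins G) => /e_asym ->.
move=> w; rewrite mem_enum !mem_cat mem_rev (mem_outs G) !mem_filter (mem_ins G) /= negbK.
rewrite [w \in adj e v]/(adj e v w) /adj.
by case: (e v w); case: (e w v); case: (_ \in L).
Qed.

(** Moving [insL] from the front of [ins v ++ rev (outs v)] to its end gives the canonical list. *)
Lemma canonical_rotation_rot v :
  exists k, canonical_rotation e rank book_page v = rot k (rotation M v).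
Proof.
have -> : canonical_rotation e rank book_page v = rot (size (insL v)) (ins v ++ rev (outs v)).
  by rewrite canonical_rotationE catA -rot_size_cat catA -ins_pages.
have [k ->] := rot_sym_ex (rotationE v); exact: rot_rot_ex.
Qed.

Lemma rank_s v : (rank v == 0 :> nat) = (v == s).
Proof.
have le_s w : pos s <= pos w.
  have /connectP[p sp ->] := source_reaches G w.
  elim: p s sp => //= a p IH b /andP[/edge_pos ba /IH].
  exact: leq_trans (ltnW ba).
apply/eqP/eqP=> [v0|->].
  apply: pos_injective; apply/eqP; rewrite eqn_leq le_s andbT leqNgt -rank_lt v0.
  by rewrite ltn0.
by apply: eq_card0 => u; rewrite in_set ltnNge le_s.
Qed.

Lemma uniq_rotation v : uniq (rotation M v).
Proof.
have [k ->] := rotationE v; rewrite rot_uniq.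
rewrite cat_uniq (uniq_ins G) rev_uniq (uniq_outs G) andbT; apply/hasPn=> w.
by rewrite mem_rev (mem_outs G) /= (mem_ins G) => /e_asym ->.
Qed.

Lemma face_of_canonical d :
  face_of (Embedding (canonical_rotation e rank book_page) set0) d = face_of M d.
Proof.
apply/setP=> d'; rewrite !in_set; apply: eq_fconnect => -[u v]; congr pair => /=.
by have [k ->] := canonical_rotation_rot v; rewrite prev_rot // uniq_rotation.
Qed.

(** The lowest vertex is [s], which has no in-arcs; its last arc counterclockwise is therefore the
    leftmost out-edge, whose left face is the outer face of [M]. *)
Lemma embedding_preserving_rank : embedding_preserving e rank book_page M.
Proof.
split; first exact: canonical_rotation_rot.
have ins_s : ins s = [::].
  case sE: (ins s) => [|u I] //; have := mem_ins G s u.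
  by rewrite sE mem_head (negPf (source_in G u)).
have last_s : last s (canonical_rotation e rank book_page s) = head s (outs s).
  rewrite canonical_rotationE /insL /insR ins_s /= cats0.
  by case: (outs s) => //= w O; rewrite rev_cons last_rcons.
apply/setP=> d; rewrite outerE [LHS]in_set; apply/existsP/idP=> [[v]|d_out].
  by rewrite rank_s => /andP[/eqP ->]; rewrite face_of_canonical last_s.
by exists s; rewrite rank_s eqxx face_of_canonical last_s.
Qed.

End CanonicalEmbedding.

(* When s = t the graph is a single vertex. *)
Lemma one_vertex_case (V : finType) (e : rel V) (s : V) (M : embedding V) :
  plane_st_graph e M s s ->
  exists (pi : V -> 'I_#|V|) (sigma : V * V -> page),
    two_UBE e pi sigma /\ embedding_preserving e pi sigma M.
Proof.
move=> plane; have no_edge u v : e u v = false.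
  apply/negP=> uv.
  have : connect e s u by exact: connect_source plane u.
  case/connectP=> -[|a p] /=; last by rewrite (negPf (t_no_out plane a)).
  by move=> _ us; rewrite us (negPf (t_no_out plane v)) in uv.
have allV v : v = s by apply/(plane_source plane) => u; rewrite no_edge.
have allD (d : V * V) : d = (s, s) by case: d => a b; rewrite (allV a) (allV b).
have canon0 pi sigma v : canonical_rotation e pi sigma v = [::].
  rewrite /canonical_rotation; have -> // : enum (adj e v) = [::].
  by rewrite -(enum0 V); apply: eq_enum => w; rewrite [LHS]/(adj e v w) /adj !no_edge.
have rot0 v : rotation M v = [::].
  by case: (rotation M v) (mem_rot_ plane v) => // a l /(_ a); rewrite mem_head !no_edge.
exists enum_rank, (fun => LeftPage); split.
  split=> [|u v|a b c d]; rewrite ?no_edge //.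
  by exists enum_val; [apply: enum_rankK | apply: enum_valK].
split=> [v|]; first by exists 0; rewrite /= canon0 rot0.
case: plane => _ _ _ /imsetP[d0 _ ->] _; apply/setP=> d.
rewrite !in_set (allD d) (allD d0) connect0; apply/existsP; exists s.
rewrite canon0 in_set connect0 andbT -leqn0 -ltnS.
by rewrite (leq_trans (ltn_ord _)) // (eq_card1 (x := s)) // => v; rewrite (allV v) !inE eqxx.
Qed.

Theorem theorem3 (V : finType) (e : rel V) (s t : V) (M : embedding V) :
  plane_st_graph e M s t ->
  (forall f : {set V * V}, f \in internal_faces M ->
     2 <= #|left_path e M f| /\ 3 <= #|right_path e M f|) ->
  exists (pi : V -> 'I_#|V|) (sigma : V * V -> page),
    two_UBE e pi sigma /\ embedding_preserving e pi sigma M.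
Proof.
have [<-|neq_st] := eqVneq s t; first by move/one_vertex_case.
move=> plane /(plane_ordered plane neq_st)[ins [outs [G rotE outE]]].
have [pos [L [pos_inj pos_lt cross outs_order ins_order]]] := book_order G.
exists (rank pos), (book_page L); split.
  exact: two_UBE_rank.
exact: (embedding_preserving_rank G).
Qed.
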